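(* Let $p>3$ be a prime number, let $n,k$ be natural numbers, and let $G$ be a finite abelian group of order $p^n$ with $p^{k(p-1)}G=0$. Then there are a formal expression $q'(X,Y)$ built from the variables $X,Y$ using only $+$ and $\bullet$, and a formal term $t(X,Y)$ (in the sense of the context), both depending only on the abelian group $G$ (and on $p,k$ and the fixed integer $\gamma$), such that for every brace $(A,+,\circ)$ with additive group $(A,+)=G$ satisfying Properties $1'$ and $1''$, with pre-Lie ring $(P,+,\bullet)$, $P=A/ann(p^{2k})$, the following holds. 1. For all $a,b\in A$, $\;p^{2k}([a]\odot[b])=q'([a],[b])$ in $P$. 2. The brace $Q=A/ann(p^{4k})$ is recovered from the pre-Lie ring $(P,+,\bullet)$ by means of $t$: the addition of $Q$ is induced from $P$, and for all $x,y\in P$ and all choices of division functions $\rho^{-1}$ the value $t(x,y)$ is defined, does not depend on the choice of the functions $\rho^{-1}$, and satisfies $\bar x*\bar y=t(x,y)$ in $Q$, where $\bar x,\bar y$ denote the images of $x,y$ in $Q$.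
   Context: A (left) brace is a set $A$ with operations $+,\circ$ such that $(A,+)$ is an abelian group, $(A,\circ)$ is a group and $a\circ(b+c)+a=a\circ b+a\circ c$ for all $a,b,c$. Put $a*b=a\circ b-a-b$. An ideal is an additive subgroup $I$ with $i*a,\,a*i\in I$ for all $i\in I,a\in A$; then $A/I$ is a brace. Write $p^iA=\{p^ia:a\in A\}$ and $ann(p^i)=\{a\in A:p^ia=0\}$. Let $m=\lfloor (p-1)/4\rfloor$. Property $1'$: for all $a,b\in A$, $a*(a*(\cdots*(a*b)\cdots))\in pA$ with $a$ appearing $m$ times, and $a*(a*(\cdots*(a*a)\cdots))\in pA$ with $a$ appearing $m$ times in total. Property $1''$: for all $a\in A$, $i\ge 1$, $c\in ann(p^i)$, $a*(a*(\cdots*(a*c)\cdots))\in ann(p^{i-1})$ with $a$ appearing $m$ times. For braces of order $p^n$ satisfying both properties the sets $p^iA$ and $ann(p^i)$ are ideals. Operations on $P=A/ann(p^{2k})$: write $[a]$ for the class of $a$ in $P$. Fix $\wp^{-1}:p^kA\to A$ with $p^k\wp^{-1}(x)=x$ for all $x\in p^kA$. Put $[x]\odot[y]=[\wp^{-1}((p^kx)*y)]$. Fix a primitive root $\gamma$ modulo $p^n$, put $\xi=\gamma^{p^{n-1}}$, and define $[x]\bullet[y]=\sum_{i=0}^{p-2}\xi^{p-1-i}\,([\xi^ix]\odot[y])$. These operations are well defined and $(P,+,\bullet)$ is a pre-Lie ring, i.e. $\bullet$ is biadditive and $(x\bullet y)\bullet z-x\bullet(y\bullet z)=(y\bullet x)\bullet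 z-y\bullet(x\bullet z)$. Formal terms: identify $Q=A/ann(p^{4k})$ with $P/ann_P(p^{2k})$, where $ann_P(p^{2k})=\{x\in P:p^{2k}x=0\}$. A division function on an abelian group $H$ is a function $\rho^{-1}:pH\to H$ with $p\rho^{-1}(z)=z$ for all $z\in pH$. A formal term $t(X,Y)$ is a finite expression built from variables $X,Y$ (ranging over $P$) using addition in $P$, addition in $Q$, the operation $\bullet$ on $P$, division functions $\rho^{-1}$ on $P$ and on $Q$, and the operation of taking cosets $P\to Q$. The value is defined if every occurrence of $\rho^{-1}$ is applied to an element divisible by $p$ in the group concerned. *)

(* Defs.v *)
From HB Require Import structures.
From mathcomp Require Import all_boot all_order all_algebra.

Set Implicit Arguments.
Unset Strict Implicit.
Unset Printing Implicit Defensive.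

Import GRing.Theory.
Local Open Scope ring_scope.
Local Open Scope quotient_scope.

Section Divisibility.
Variable H : zmodType.

Definition divisible (N : nat) (z : H) : Prop := exists w, z = w *+ N.

(* A division function is only defined on N H; it is represented by a total
   function whose values outside N H are arbitrary and never used. *)
Definition division_fun (N : nat) (rho : H -> H) : Prop :=
  forall z, divisible N z -> rho z *+ N = z.

Definition ann (N : nat) : {pred H} := [pred x | x *+ N == 0].

Lemma ann_zmod_closed N : zmod_closed (ann N).
Proof.
split=> [|x y]; rewrite !inE ?mul0rn // => /eqP hx /eqP hy.
by rewrite mulrnBl hx hy subr0.
Qed.

HB.instance Definition _ N :=
  GRing.isZmodClosed.Build H (ann N) (ann_zmod_closed N).

End Divisibility.

Notation quot_ann H N := (Quotient.quot (@ann H N)).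

Section CosetMap.
Variables (G : zmodType) (M N : nat).

(* When M divides N, this is the canonical surjection of G / ann(M) onto
   G / ann(N); by the lemmas below it identifies G / ann(N) with the quotient
   of G / ann(M) by the (N / M)-torsion of the latter. *)
Definition coset_map : quot_ann G M -> quot_ann G N :=
  lift_fun1 (quot_ann G M) (\pi_(quot_ann G N)).

Hypothesis dvdMN : (M %| N)%N.

Lemma coset_map_pi (a : G) :
  coset_map (\pi_(quot_ann G M) a) = \pi_(quot_ann G N) a.
Proof.
rewrite /coset_map; unlock; apply/eqP.
rewrite -Quotient.idealrBE inE -(divnK dvdMN) mulnC mulrnA.
have: repr (\pi_(quot_ann G M) a) - a \in ann M.
  by rewrite Quotient.idealrBE reprK.
by rewrite inE => /eqP ->; rewrite mul0rn.
Qed.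

Lemma coset_mapD : {morph coset_map : x y / x + y}.
Proof.
move=> x y; rewrite -[x]reprK -[y]reprK.
by rewrite -[X in coset_map X]Quotient.pi_add !coset_map_pi Quotient.pi_add.
Qed.

Lemma coset_map_surj (u : quot_ann G N) : exists x, coset_map x = u.
Proof. by exists (\pi_(quot_ann G M) (repr u)); rewrite coset_map_pi reprK. Qed.

Lemma coset_map_ker (x : quot_ann G M) :
  (coset_map x == 0) = (x *+ (N %/ M) == 0).
Proof.
have pi_0 K : \pi_(quot_ann G K) 0 = 0 by rewrite !piE.
have pi_eq0 K (a : G) : (\pi_(quot_ann G K) a == 0) = (a *+ K == 0).
  by rewrite -pi_0 -Quotient.idealrBE subr0 inE.
have piMn (a : G) j : \pi_(quot_ann G M) a *+ j = \pi_(quot_ann G M) (a *+ j).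
  elim: j => [|j IH]; first by rewrite !mulr0n pi_0.
  by rewrite !mulrS IH Quotient.pi_add.
by rewrite -[x]reprK coset_map_pi piMn !pi_eq0 -mulrnA divnK.
Qed.

End CosetMap.

Record brace (A : zmodType) := Brace {
  circ :> A -> A -> A;
  circ_unit : A;
  circ_inv : A -> A;
  circA : associative circ;
  circ1a : left_id circ_unit circ;
  circa1 : right_id circ_unit circ;
  circVa : left_inverse circ_unit circ_inv circ;
  circaV : right_inverse circ_unit circ_inv circ;
  brace_distr : forall a b c, circ a (b + c) + a = circ a b + circ a c
}.

Definition star (A : zmodType) (op : A -> A -> A) (a b : A) : A :=
  op a b - a - b.

Section Properties.
Variables (p : nat) (A : zmodType) (B : brace A).
Local Notation m := ((p - 1) %/ 4)%N.

(* In the second clause m copies of a occur in total, hence m - 1 iterations. *)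
Definition property1' : Prop :=
  (forall a b : A, divisible p (iter m (star B a) b)) /\
  (forall a : A, divisible p (iter (m - 1) (star B a) a)).

Definition property1'' : Prop :=
  forall (a : A) (i : nat) (c : A), (1 <= i)%N ->
    c \in ann (p ^ i) -> iter m (star B a) c \in ann (p ^ (i - 1)).

End Properties.

Definition primitive_root (g : int) (N : nat) : Prop :=
  coprimez g N /\
  forall z : int, coprimez z N -> exists j : nat, (z = g ^+ j %[mod N])%Z.

Section PreLie.
Variables (p n k : nat) (gamma : int) (G : zmodType).
Variables (B : brace G) (winv : G -> G).
Local Notation P := (quot_ann G (p ^ (2 * k))).
Local Notation xi := (gamma ^+ (p ^ (n - 1))).

(* lift_op2 evaluates an operation of G on representatives of classes. *)
Definition odot : P -> P -> P :=
  lift_op2 P (fun x y => winv (star B (x *+ p ^ k) y)).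

Definition bullet (x y : P) : P :=
  \sum_(i < p - 1) odot (x *~ xi ^+ i) y *~ xi ^+ (p - 1 - i).

End PreLie.

Arguments odot p k {G} B winv x y : rename.
Arguments bullet p n k gamma {G} B winv x y : rename.

Definition quot_circ (A : zmodType) (B : brace A) (N : nat) :
    quot_ann A N -> quot_ann A N -> quot_ann A N :=
  lift_op2 (quot_ann A N) B.

Arguments quot_circ {A} B N x y : rename.

Inductive prelie_expr : Type :=
  | EX | EY
  | EAdd of prelie_expr & prelie_expr
  | EMul of prelie_expr & prelie_expr.

Fixpoint eval_expr (P : zmodType) (mul : P -> P -> P) (x y : P)
    (e : prelie_expr) : P :=
  match e with
  | EX => x
  | EY => y
  | EAdd e1 e2 => eval_expr mul x y e1 + eval_expr mul x y e2
  | EMul e1 e2 => mul (eval_expr mul x y e1) (eval_expr mul x y e2)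
  end.

(* Formal terms are two-sorted: Pterm has values in P, Qterm in Q. *)
Inductive Pterm : Type :=
  | PX | PY
  | PAdd of Pterm & Pterm
  | PMul of Pterm & Pterm
  | PDiv of Pterm.

Inductive Qterm : Type :=
  | QCoset of Pterm
  | QAdd of Qterm & Qterm
  | QDiv of Qterm.

Section Terms.
Variables (p : nat) (P Q : zmodType) (mul : P -> P -> P) (coset : P -> Q).
Variables (rhoP : P -> P) (rhoQ : Q -> Q) (x y : P).

Fixpoint evalP (t : Pterm) : P :=
  match t with
  | PX => x
  | PY => y
  | PAdd t1 t2 => evalP t1 + evalP t2
  | PMul t1 t2 => mul (evalP t1) (evalP t2)
  | PDiv t1 => rhoP (evalP t1)
  end.

Fixpoint definedP (t : Pterm) : Prop :=
  match t with
  | PX | PY => True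
  | PAdd t1 t2 | PMul t1 t2 => definedP t1 /\ definedP t2
  | PDiv t1 => definedP t1 /\ divisible p (evalP t1)
  end.

Fixpoint evalQ (t : Qterm) : Q :=
  match t with
  | QCoset t1 => coset (evalP t1)
  | QAdd t1 t2 => evalQ t1 + evalQ t2
  | QDiv t1 => rhoQ (evalQ t1)
  end.

Fixpoint definedQ (t : Qterm) : Prop :=
  match t with
  | QCoset t1 => definedP t1
  | QAdd t1 t2 => definedQ t1 /\ definedQ t2
  | QDiv t1 => definedQ t1 /\ divisible p (evalQ t1)
  end.

End Terms.

(* Main.v *)
Require Import Defs.
From mathcomp Require Import all_boot all_order all_algebra.
From HB Require Import structures.
From mathcomp Require Import ssrAC cyclic zify.

Set Implicit Arguments.
Unset Strict Implicit.
Unset Printing Implicit Defensive.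

Import GRing.Theory.
Local Open Scope ring_scope.
Local Open Scope quotient_scope.

(** Write [L a] for the additive endomorphism [a * _] of the brace [A] and
    [m] for [(p - 1) / 4], so that [L] turns the circle operation into
    [1 + L (a o b) = (1 + L a) (1 + L b)].  The two properties say that every
    [l = L a] is contracting: [l ^ m] maps [A] into [p A] and [ann (p ^ i.+1)]
    into [ann (p ^ i)].  Three ideas carry the proof.

    Division.  For a contracting [l] the operator [l ^ (2 m) / p] makes sense:
    divide [l ^ m y] by [p] in any way and apply [l ^ m], which kills the
    ambiguity [ann p].  Since [2 m < p - 1], the divided binomial series
      [F l = ((1 + l) ^ (p ^ k) - 1) / p ^ k = l * U l]
    is then an operator ([rootF], [rootU]) with [U l] unipotent.  On the
    operators [l * g] with [g] in the bicommutant of [l] the map [F] is an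
    injection of a finite set into itself, so that a power of [F] with an
    exponent depending on the group only is the identity
    ([rootF_period]): [F] is inverted by iterating it, with no inverse series.
    As the [p ^ k]-th circle power of [a] is [p ^ k U (L a) a] and has operator
    [p ^ k F (L a)], it follows that [ann (p ^ i)] is an ideal ([staro_ann]),
    and that circle powers separate the classes modulo [ann (p ^ i)]; by
    counting, every element of [p ^ i A] is a [p ^ i]-th circle power
    ([mulp_is_cpow]), whence [p ^ i A * A] lies in [p ^ i A].

    Linearization.  On [P = A / ann (p ^ (2 k))] put [D x y = x odot y] and
    [q = p ^ k].  The circle operation on [p ^ k A] becomes the group law
    [x + y + q D x y], with [D] of it equal to [D x + D y + q D x D y].
    Writing multiples [x *+ t] as products of powers in this group shows that
    [D (x *+ i + y *+ j)] is a polynomial in [i] and [j] in which monomials of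
    degree [d.+1] carry a factor [q ^ d] ([slow_flow]).  As [q ^ (p - 2) = 0]
    on [P], the degrees stay below [p - 1]; so averaging against powers of
    [xi] extracts the homogeneous parts of [D], [bullet] is [p - 1] times the
    linear one, and it is biadditive.  Differentiating [t |-> D (x *+ t)] along
    the group law gives a recursion that computes the homogeneous parts from
    [bullet] ([hpart_rec]).  Hence [odot] itself is one fixed expression in
    [bullet] ([flow_expressible]), which gives the first claim.

    Reconstruction.  On [P] the map [h x = U (L x) x] satisfies
    [D (h x) = F (L x)].  Therefore [L x] is obtained from [D (h x)] by
    iterating [F], and [x] from [h x] by a power of [U (L x)]; this computes
    the inverse of [h] by formal terms, in which the only divisions are those of
    [l ^ (2 m) / p] and hence have a value independent of the choices.  So [h]
    is a permutation of [P]; iterating its inverse computes [h] as well, and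
    [L x] is recovered from [D (h x)] ([computes_star]). *)

(** * The endomorphism ring of a finite abelian group *)

Section Endomorphisms.
Variable H : finZmodType.

Definition additiveb : {pred {ffun H -> H}} :=
  [pred f : {ffun H -> H} | [forall x, forall y, f (x + y) == f x + f y]].

Lemma additivebP (f : {ffun H -> H}) :
  reflect {morph f : x y / x + y} (f \in additiveb).
Proof.
apply: (iffP forallP) => [h x y|h x]; first by apply/eqP/(forallP (h x)).
by apply/forallP=> y; rewrite h.
Qed.

Lemma additiveb_zmod_closed : zmod_closed additiveb.
Proof.
split=> [|f g /additivebP hf /additivebP hg]; apply/additivebP=> x y.
  by rewrite !ffunE addr0.
by rewrite !ffunE hf hg opprD addrACA.
Qed.

HB.instance Definition _ :=
  GRing.isZmodClosed.Build {ffun H -> H} additiveb additiveb_zmod_closed.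

Record endo := Endo { endo_val : {ffun H -> H}; _ : endo_val \in additiveb }.

HB.instance Definition _ := [isSub for endo_val].
HB.instance Definition _ := [Finite of endo by <:].
HB.instance Definition _ := [SubChoice_isSubZmodule of endo by <:].

Definition endo_app (f : endo) : H -> H := endo_val f.
Coercion endo_app : endo >-> Funclass.
Arguments endo_app f x : simpl never.

Lemma endo_appD (f : endo) : {morph f : x y / x + y}.
Proof. by apply/additivebP; case: f. Qed.

Lemma endo_app_zmod (f : endo) : zmod_morphism f.
Proof.
move=> x y; apply: (addIr (f y)).
by rewrite -endo_appD !subrK.
Qed.

HB.instance Definition _ (f : endo) :=
  GRing.isZmodMorphism.Build H H (endo_app f) (endo_app_zmod f).

Lemma endoP (f g : endo) : f =1 g -> f = g.
Proof. by move=> h; apply/val_inj/ffunP=> x; exact: h. Qed.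

Lemma mk_endo_subproof (f : H -> H) :
  {morph f : x y / x + y} -> finfun f \in additiveb.
Proof. by move=> h; apply/additivebP=> x y; rewrite !ffunE h. Qed.

Definition mk_endo (f : H -> H) (fD : {morph f : x y / x + y}) : endo :=
  Endo (mk_endo_subproof fD).

Lemma mk_endoE f (fD : {morph f : x y / x + y}) : mk_endo fD =1 f.
Proof. by move=> x; rewrite /endo_app /= ffunE. Qed.

Lemma idD : {morph (@id H) : x y / x + y}. Proof. by []. Qed.

Lemma compD (f g : endo) : {morph (f \o g) : x y / x + y}.
Proof. by move=> x y; rewrite /comp !endo_appD. Qed.

Definition endo_one := mk_endo idD.
Definition endo_mul (f g : endo) := mk_endo (compD f g).

Lemma endo_mulE (f g : endo) x : endo_mul f g x = f (g x).
Proof. exact: mk_endoE. Qed.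

Lemma endo_oneE x : endo_one x = x. Proof. exact: mk_endoE. Qed.

Lemma endo_addE (f g : endo) x : (f + g) x = f x + g x.
Proof. by rewrite /endo_app [endo_val _](raddfD val) ffunE. Qed.

Fact endo_mulA : associative endo_mul.
Proof. by move=> f g h; apply: endoP=> x; rewrite !(endo_mulE, endo_oneE). Qed.

Fact endo_mul1 : left_id endo_one endo_mul.
Proof. by move=> f; apply: endoP=> x; rewrite !(endo_mulE, endo_oneE). Qed.

Fact endo_mulr1 : right_id endo_one endo_mul.
Proof. by move=> f; apply: endoP=> x; rewrite !(endo_mulE, endo_oneE). Qed.

Fact endo_mulDl : left_distributive endo_mul +%R.
Proof.
by move=> f g h; apply: endoP=> x; rewrite !(endo_addE, endo_mulE).
Qed.

Fact endo_mulDr : right_distributive endo_mul +%R.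
Proof.
move=> f g h; apply: endoP=> x; rewrite !(endo_addE, endo_mulE).
by rewrite endo_appD.
Qed.

HB.instance Definition _ := GRing.Zmodule_isPzRing.Build endo
  endo_mulA endo_mul1 endo_mulr1 endo_mulDl endo_mulDr.

Implicit Types (f g : endo) (x : H).

Lemma appD f x y : f (x + y) = f x + f y. Proof. exact: raddfD. Qed.
Lemma app0 f : f 0 = 0. Proof. exact: raddf0. Qed.
Lemma appB f x y : f (x - y) = f x - f y. Proof. exact: raddfB. Qed.
Lemma appMn f x N : f (x *+ N) = f x *+ N. Proof. exact: raddfMn. Qed.
Lemma app_sum f (I : Type) (r : seq I) (P : pred I) (F : I -> H) :
  f (\sum_(i <- r | P i) F i) = \sum_(i <- r | P i) f (F i).
Proof. exact: raddf_sum. Qed.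

Lemma endoM f g x : (f * g) x = f (g x). Proof. exact: mk_endoE. Qed.
Lemma endo1 x : (1 : endo) x = x. Proof. exact: mk_endoE. Qed.
Lemma endo0 x : (0 : endo) x = 0.
Proof. by rewrite /endo_app [endo_val _](raddf0 val) ffunE. Qed.
Lemma endoD f g x : (f + g) x = f x + g x. Proof. exact: endo_addE. Qed.
Lemma endoN f x : (- f) x = - f x.
Proof. by rewrite /endo_app [endo_val _](raddfN val) ffunE. Qed.

Lemma endoMn f N x : (f *+ N) x = f x *+ N.
Proof. by elim: N => [|N IH]; rewrite ?endo0 // !mulrS endoD IH. Qed.

Lemma endo_sum (I : Type) (r : seq I) (P : pred I) (F : I -> endo) x :
  (\sum_(i <- r | P i) F i) x = \sum_(i <- r | P i) F i x.
Proof. by elim/big_rec2: _ => [|i y z _ <-]; rewrite ?endo0 ?endoD. Qed.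

Lemma endoX f N x : (f ^+ N) x = iter N f x.
Proof. by elim: N => [|N IH]; rewrite ?endo1 // exprS endoM IH. Qed.

End Endomorphisms.

Definition endoE := (endoM, endo1, endo0, endoD, endoN, endoMn).

(** The exponent depends on the ambient type alone, which is what makes it
    usable in terms that must not depend on the brace. *)
Lemma iter_fact_card (T : finType) (S : {pred T}) (f : T -> T) :
  {homo f : x / x \in S} -> {in S &, injective f} ->
  {in S, forall x, iter #|T|`! f x = x}.
Proof.
move=> fS finj x xS.
have le_ord : (fingraph.order f x <= #|T|)%N by exact: max_card.
have /dvdnP [c ->] : (fingraph.order f x %| #|T|`!)%N.
  by rewrite dvdn_fact // fingraph.order_gt0.
elim: c => [|c IH]; first by rewrite mul0n.
rewrite mulSn addnC iterD.
by rewrite (iter_order_in fS finj xS).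
Qed.

(** * Dividing powers of a contracting operator by p *)

Section Calculus.
Variables (p m : nat).
Hypotheses (p_pr : prime p) (m_gt0 : (0 < m)%N) (m_le : (4 * m <= p.-1)%N).

Definition contracting (H : finZmodType) (l : endo H) : Prop :=
  (forall x, divisible p ((l ^+ m) x)) /\
  (forall i c, c *+ p ^ i.+1 = 0 -> (l ^+ m) c *+ p ^ i = 0).

Definition pdivide (H : finZmodType) (z : H) : H :=
  odflt 0 [pick w | w *+ p == z].

Lemma pdivideK (H : finZmodType) (z : H) :
  divisible p z -> pdivide z *+ p = z.
Proof.
case=> w zE; rewrite /pdivide; case: pickP => [u /eqP //|/(_ w)].
by rewrite zE eqxx.
Qed.

(** The operator [l ^ (2 m) / p]: the middle division by [p] is ambiguous up to
    [ann p], which the outer [l ^ m] kills when [l] is contracting. *)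
Definition divpow (H : finZmodType) (l : endo H) : endo H :=
  insubd 0 [ffun y => (l ^+ m) (pdivide ((l ^+ m) y))].

(** ['C(p ^ k, i) / p ^ k] up to the power of [p] in its denominator, which is
    that of [i]; this power is supplied by [divpow]. *)
Definition dcoef (k i : nat) : nat :=
  (('C(p ^ k, i) * p ^ logn p i) %/ p ^ k)%N.

(** [rootU k l] is the series [((1 + l) ^ (p ^ k) - 1) / (p ^ k l)], and [rootF]
    is its product with [l]. *)
Definition rootU (H : finZmodType) (k : nat) (l : endo H) : endo H :=
  \sum_(i < p ^ k)
    (l ^+ (i - 2 * m * logn p i.+1) * divpow l ^+ logn p i.+1) *+ dcoef k i.+1.

Definition rootF (H : finZmodType) (k : nat) (l : endo H) : endo H :=
  l * rootU k l.


Lemma dcoefE k i : (dcoef k i.+1 * p ^ k = 'C(p ^ k, i.+1) * p ^ logn p i.+1)%N.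
Proof.
rewrite /dcoef divnK //.
have [c cp iE] := pfactor_coprime p_pr (ltn0Sn i).
have cop : coprime (p ^ k) c by rewrite coprimeXl.
rewrite -(Gauss_dvdr _ cop) mulnCA -iE mulnC -mul_bin_diag.
by rewrite dvdn_mulr.
Qed.

#[global] Opaque dcoef.

Lemma dcoef1 k : dcoef k 1 = 1%N.
Proof.
have := dcoefE k 0; rewrite bin1 logn1 muln1 -[RHS]mul1n => /eqP.
by rewrite eqn_pmul2r ?expn_gt0 ?prime_gt0 // => /eqP.
Qed.

(** There are enough factors [l] in the term of degree [i] to absorb the power
    of [p] in its denominator: [p ^ v <= i.+1] forces [v (p - 1) <= i], while
    each division consumes only [2 m] of them, and [4 m <= p - 1]. *)
Lemma logn_lt i : (0 < i)%N -> (2 * m * logn p i.+1 < i)%N.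
Proof.
move=> i_gt0; set v := logn p i.+1.
case: (posnP v) => [->|v_gt0]; first by rewrite muln0.
have le_pv : (p ^ v <= i.+1)%N by rewrite dvdn_leq // pfactor_dvdnn.
have bern : (v * p.-1 < p ^ v)%N.
  have p_gt0 := prime_gt0 p_pr.
  elim: (v) => [|u IH]; first by rewrite mul0n.
  have : (0 < p ^ u)%N by rewrite expn_gt0 p_gt0.
  by rewrite expnS; nia.
by nia.
Qed.

Lemma logn_le i : (2 * m * logn p i.+1 <= i)%N.
Proof. by case: i => [|i]; [rewrite logn1 muln0 | apply/ltnW/logn_lt]. Qed.

Section Operator.
Variable H : finZmodType.
Implicit Types (l f g : endo H).


Lemma divpowE l y z :
  contracting l -> (l ^+ m) y = z *+ p -> divpow l y = (l ^+ m) z.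
Proof.
move=> [lp lann]; set t := [ffun u => (l ^+ m) (pdivide ((l ^+ m) u))].
have tE u w : (l ^+ m) u = w *+ p -> t u = (l ^+ m) w.
  move=> uE; rewrite ffunE; apply/eqP; rewrite -subr_eq0 -appB.
  apply/eqP; rewrite -[LHS]mulr1n; apply: (lann 0%N).
  rewrite expn1 mulrnBl pdivideK //.
  by rewrite uE subrr.
have t_add : t \in @additiveb H.
  apply/additivebP=> u v.
  rewrite (tE u _ (esym (pdivideK (lp u)))) (tE v _ (esym (pdivideK (lp v)))).
  by rewrite -appD; apply: tE; rewrite mulrnDl !pdivideK // appD.
by move=> yE; rewrite /divpow /endo_app [endo_val _]insubdK //; exact: tE.
Qed.

#[global] Opaque divpow.

Lemma contractingM l g : contracting l -> GRing.comm l g -> contracting (l * g).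
Proof.
move=> [lp lann] lg; split=> [x|i c c0].
  by rewrite exprMn_comm // endoM; apply: lp.
by rewrite exprMn_comm // endoM lann // -appMn c0 app0.
Qed.

Lemma divpow_p l : contracting l -> divpow l *+ p = l ^+ (2 * m).
Proof.
move=> lc; apply: endoP=> y; have [z yE] := lc.1 y.
by rewrite endoMn (divpowE lc yE) -appMn -yE -endoM -exprD addnn mul2n.
Qed.

(** Divided powers of [l] commute with everything that commutes with [l], so
    that all operators built from [l] lie in its bicommutant. *)
Lemma divpow_comm l g :
  contracting l -> GRing.comm g l -> GRing.comm g (divpow l).
Proof.
move=> lc gl; apply: endoP=> y; have [z yE] := lc.1 y.
have glm u : g ((l ^+ m) u) = (l ^+ m) (g u).
  by rewrite -!endoM; congr (endo_app _ _); exact: commrX.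
rewrite !endoM (divpowE lc yE) glm (divpowE (z := g z) lc) //.
by rewrite -glm yE appMn.
Qed.

Lemma divpowM l g : contracting l -> GRing.comm l g ->
  divpow (l * g) = divpow l * g ^+ (2 * m).
Proof.
move=> lc lg; have gl := commr_sym lg.
rewrite (commrX (2 * m) (commr_sym (divpow_comm lc gl))).
apply: endoP=> y; have [z yE] := lc.1 y.
have lgm : (l * g) ^+ m = g ^+ m * l ^+ m.
  by rewrite exprMn_comm //; apply/commrX/commr_sym/commrX.
rewrite endoM (divpowE lc yE) (divpowE (z := (g ^+ m) z) (contractingM lc lg)).
  rewrite -!endoM lgm mul2n -addnn exprD -!mulrA.
  by congr (endo_app (_ * _) _); apply/commrX/commr_sym/commrX.
by rewrite lgm endoM yE appMn.
Qed.

Lemma rootU_comm k l g :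
  contracting l -> GRing.comm g l -> GRing.comm g (rootU k l).
Proof.
move=> lc gl; apply: commr_sum => i _; apply/commrMn/commrM; apply: commrX => //.
exact: divpow_comm.
Qed.

Lemma rootU_p k l : contracting l ->
  rootU k l *+ p ^ k = \sum_(i < p ^ k) l ^+ i *+ 'C(p ^ k, i.+1).
Proof.
move=> lc; rewrite /rootU -sumrMnl; apply: eq_bigr => i _.
rewrite -mulrnA dcoefE [('C(_, _) * _)%N]mulnC mulrnA; congr (_ *+ _).
rewrite -mulrnAr; set v := logn p i.+1.
have -> : divpow l ^+ v *+ p ^ v = l ^+ (2 * m * v).
  by rewrite -exprMn_n divpow_p // -exprM.
by rewrite -exprD subnK // logn_le.
Qed.

Lemma rootF_p k l : contracting l -> rootF k l *+ p ^ k = (1 + l) ^+ (p ^ k) - 1.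
Proof.
move=> lc; rewrite /rootF -mulrnAr rootU_p // [1 + l]addrC exprD1n big_ord_recl.
rewrite bin0 expr0 mulr1n addrC addKr mulr_sumr; apply: eq_bigr => i _.
by rewrite mulrnAr -exprS.
Qed.


Lemma rootF_contracting k l : contracting l -> contracting (rootF k l).
Proof. by move=> lc; apply: contractingM => //; exact: rootU_comm. Qed.

(** An equality [f *+ N = g *+ N] says that [f] and [g] agree modulo [ann N].
    It is a congruence because operators commute with multiplication by [N];
    with [N] a power of [p] it is also respected by division by [p], at the
    price of one more use of contraction. *)
Lemma cong_mul N f f' g g' : f *+ N = f' *+ N -> g *+ N = g' *+ N ->
  (f * g) *+ N = (f' * g') *+ N.
Proof. by move=> ff' gg'; rewrite -mulrnAl ff' mulrnAl -mulrnAr gg' mulrnAr. Qed.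

Lemma cong_exp N f f' e : f *+ N = f' *+ N -> (f ^+ e) *+ N = (f' ^+ e) *+ N.
Proof.
move=> ff'; elim: e => [|e IH]; first by rewrite !expr0.
by rewrite !exprS; apply: cong_mul.
Qed.

Lemma cong_natmul N c f f' : f *+ N = f' *+ N -> f *+ c *+ N = f' *+ c *+ N.
Proof. by move=> ff'; rewrite !(mulrnAC _ c) ff'. Qed.

Lemma cong_divpow i l l' : contracting l -> contracting l' ->
  l *+ p ^ i = l' *+ p ^ i -> divpow l *+ p ^ i = divpow l' *+ p ^ i.
Proof.
move=> lc lc' ll'; apply: endoP=> y.
have [z yE] := lc.1 y; have [z' yE'] := lc'.1 y.
have llm u : (l ^+ m) u *+ p ^ i = (l' ^+ m) u *+ p ^ i.
  by rewrite -[LHS]endoMn -[RHS]endoMn (cong_exp m ll').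
rewrite [LHS]endoMn [RHS]endoMn (divpowE lc yE) (divpowE lc' yE') llm.
apply/eqP; rewrite -subr_eq0 -mulrnBl -appB; apply/eqP.
apply: lc'.2; rewrite expnS mulrnA mulrnBl -yE -yE' mulrnBl llm.
by rewrite subrr.
Qed.

Lemma cong_rootU k i l l' : contracting l -> contracting l' ->
  l *+ p ^ i = l' *+ p ^ i -> rootU k l *+ p ^ i = rootU k l' *+ p ^ i.
Proof.
move=> lc lc' ll'; rewrite -[LHS]sumrMnl -[RHS]sumrMnl; apply: eq_bigr => j _.
apply: cong_natmul.
by apply: cong_mul; apply: cong_exp; [exact: ll' | exact: cong_divpow].
Qed.

Lemma cong_rootF k i l l' : contracting l -> contracting l' ->
  l *+ p ^ i = l' *+ p ^ i -> rootF k l *+ p ^ i = rootF k l' *+ p ^ i.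
Proof. by move=> lc lc' ll'; apply: (cong_mul ll'); exact: cong_rootU. Qed.

(** ** Inverting [rootF] by iteration *)

(** The bicommutant of [l]: a finite commutative ring containing [l] and its
    divided powers. *)
Definition bicomm l : {pred endo H} :=
  [pred g | [forall f : endo H, (f * l == l * f) ==> (f * g == g * f)]].

Lemma bicommP l g :
  reflect (forall f, GRing.comm f l -> GRing.comm f g) (g \in bicomm l).
Proof.
apply: (iffP forallP) => h f.
  by move=> fl; apply/eqP/(implyP (h f)); rewrite fl.
by apply/implyP=> /eqP fl; apply/eqP/h.
Qed.

Lemma bicomm_comm l f g : f \in bicomm l -> g \in bicomm l -> GRing.comm f g.
Proof.
move=> /bicommP hf /bicommP hg; apply/hg/commr_sym/hf; exact: commr_refl.
Qed.

Variable n : nat.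
Hypothesis Hpn : forall x : H, x *+ p ^ n = 0.

Lemma contracting_nilp l : contracting l -> l ^+ (m * n) = 0.
Proof.
move=> lc; apply: endoP=> y; rewrite endo0 -(Hpn (pdivide y)) exprM.
suff [z ->] : divisible (p ^ n) (((l ^+ m) ^+ n) y) by rewrite !Hpn.
elim: (n) => [|j [z zE]]; first by exists y; rewrite expr0 endo1.
have [w wE] := lc.1 z.
by exists w; rewrite exprS endoM zE appMn wE -mulrnA -expnS.
Qed.

Lemma unipotent_inv l X : contracting l -> GRing.comm l X ->
  exists V : endo H, V * (1 + l * X) = 1.
Proof.
move=> lc lX; pose y := - (l * X).
have y0 : y ^+ (m * n) = 0.
  by rewrite /y exprNn (exprMn_comm _ lX) contracting_nilp // mul0r mulr0.
exists (\sum_(i < m * n) y ^+ i).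
have -> : 1 + l * X = 1 - y by rewrite /y opprK.
have cy : GRing.comm (1 - y) (\sum_(i < m * n) y ^+ i).
  apply: commr_sum => i _; apply: commrX; apply: commr_sym.
  by apply: commrB; [apply: commr1 | apply: commr_refl].
by rewrite -cy -opprB mulNr -subrX1 y0 sub0r opprK.
Qed.

Lemma rootU_unipotent k l : contracting l ->
  exists2 X, GRing.comm l X & rootU k l = 1 + l * X.
Proof.
move=> lc; case pkE: (p ^ k)%N => [|N].
  by have := expn_gt0 p k; rewrite pkE (prime_gt0 p_pr).
rewrite /rootU pkE big_ord_recl /= logn1 muln0 subn0 dcoef1 !expr0 mul1r mulr1n.
exists (\sum_(i < N) (l ^+ (i.+1 - 2 * m * logn p i.+2).-1
             * divpow l ^+ logn p i.+2) *+ dcoef k i.+2).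
  apply: commr_sum => i _; apply/commrMn/commrM; apply: commrX.
    exact: commr_refl.
  by apply: divpow_comm => //; exact: commr_refl.
congr (_ + _); rewrite mulr_sumr; apply: eq_bigr => i _.
rewrite mulrnAr mulrA -exprS prednK // subn_gt0; exact: logn_lt.
Qed.

Lemma rootU_inv k l : contracting l -> exists V, V * rootU k l = 1.
Proof.
by move=> lc; have [X lX ->] := rootU_unipotent k lc; apply: unipotent_inv.
Qed.

Lemma rootU_period k l : contracting l -> rootU k l ^+ #|{: endo H}|`! = 1.
Proof.
move=> lc; have [V VU] := rootU_inv k lc.
have inj : {in predT &, injective (fun f => rootU k l * f)}.
  by move=> f g _ _ /= fg; rewrite -[f]mul1r -[g]mul1r -VU -!mulrA fg.
rewrite -[RHS](iter_fact_card (fun _ _ => isT) inj) //.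
by elim: _`! => [|j IH] //=; rewrite exprS IH.
Qed.

(** [rootF] preserves the multiples of [l] by elements of its bicommutant; this
    is its action on the second factor. *)
Definition cofactor k l g : endo H :=
  \sum_(i < p ^ k) (l ^+ (i - 2 * m * logn p i.+1)
     * divpow l ^+ logn p i.+1 * g ^+ i.+1) *+ dcoef k i.+1.

Lemma rootF_cofactor k l g : contracting l -> GRing.comm l g ->
  rootF k (l * g) = l * cofactor k l g.
Proof.
move=> lc lg; have gl := commr_sym lg.
have gt := divpow_comm lc gl.
rewrite /rootF -mulrA; congr (_ * _); rewrite mulr_sumr; apply: eq_bigr => i _.
rewrite mulrnAr; congr (_ *+ _); set v := logn p _.
rewrite divpowM // exprMn_comm // (exprMn_comm (x := divpow l)); last first.
  exact/commrX/commr_sym.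
set a := (i - _)%N; rewrite -exprM.
have gZ : GRing.comm g (l ^+ a * divpow l ^+ v).
  by apply: commrM; apply: commrX.
have ta : divpow l ^+ v * g ^+ a = g ^+ a * divpow l ^+ v.
  by apply/commrX/commr_sym/commrX.
rewrite -mulrA (mulrA (g ^+ a)) -ta -(mulrA _ (g ^+ a)) -exprD.
have -> : (a + 2 * m * v)%N = i by rewrite subnK // logn_le.
by rewrite (mulrA (l ^+ a)) mulrA gZ -mulrA -exprS.
Qed.

Lemma cofactor_bicomm k l g :
  contracting l -> g \in bicomm l -> cofactor k l g \in bicomm l.
Proof.
move=> lc /bicommP hg; apply/bicommP=> f fl.
apply: commr_sum => i _; apply/commrMn/commrM; last exact/commrX/hg.
by apply: commrM; apply: commrX => //; exact: divpow_comm.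
Qed.

(** The difference of two values is [(g - g') (1 + l Y)]: all terms of degree
    greater than one keep a factor [l] after the division. *)
Lemma cofactor_inj k l : contracting l -> {in bicomm l &, injective (cofactor k l)}.
Proof.
move=> lc g g' gS gS' gg'; have gcomm := bicomm_comm gS gS'.
have cS := bicommP _ _ gS; have cS' := bicommP _ _ gS'.
have ll : GRing.comm l l := commr_refl l.
have lt : GRing.comm l (divpow l) by exact: divpow_comm.
have lg := cS l ll; have lg' := cS' l ll.
pose B (i : nat) := \sum_(j < i.+1) g ^+ (i - j) * g' ^+ j.
pose A (i : nat) := l ^+ (i - 2 * m * logn p i.+1) * divpow l ^+ logn p i.+1.
have lB i : GRing.comm l (B i).
  by apply: commr_sum => j _; apply: commrM; apply: commrX.
have dA i : GRing.comm (g - g') (A i).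
  have lgg' : GRing.comm l (g - g') by apply: commrB.
  apply: commrM; apply: commrX; first exact: commr_sym.
  by apply: divpow_comm => //; exact: commr_sym.
have [Y lY EY] : exists2 Y, GRing.comm l Y &
    \sum_(i < p ^ k) A i * B i *+ dcoef k i.+1 = 1 + l * Y.
  case pkE: (p ^ k)%N => [|N].
    by have := expn_gt0 p k; rewrite pkE (prime_gt0 p_pr).
  rewrite big_ord_recl {1}/A {1}/B big_ord1 /= logn1 muln0 subn0 dcoef1.
  rewrite !expr0 !mul1r mulr1n.
  exists (\sum_(i < N) (l ^+ (i.+1 - 2 * m * logn p i.+2).-1
             * divpow l ^+ logn p i.+2) * B i.+1 *+ dcoef k i.+2).
    apply: commr_sum => i _; apply/commrMn/commrM; last exact: lB.
    by apply: commrM; apply: commrX.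
  congr (_ + _); rewrite mulr_sumr; apply: eq_bigr => i _.
  rewrite mulrnAr !mulrA -exprS prednK // subn_gt0; exact: logn_lt.
have [V VY] := unipotent_inv lc lY.
suff d0 : (g - g') * (1 + l * Y) = 0.
  apply/eqP; rewrite -subr_eq0 -[_ - _]mul1r -VY -mulrA.
  have -> : (1 + l * Y) * (g - g') = (g - g') * (1 + l * Y).
    rewrite -EY; apply/commr_sym/commr_sum => i _; apply/commrMn/commrM => //.
    apply: commr_sum => j _; apply: commrM; apply: commrX; apply: commr_sym.
      by apply: commrB => //; exact: commr_refl.
    by apply: commrB; [apply: commr_sym | exact: commr_refl].
  by rewrite d0 mulr0.
have /eqP := gg'; rewrite -subr_eq0 /cofactor -sumrB => /eqP <-.
rewrite -EY mulr_sumr; apply: eq_bigr => i _.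
rewrite -mulrnBl -mulrBr [LHS]mulrnAr -/(A i) subrXX_comm //.
by rewrite (mulrA (g - g')) (dA i) -(mulrA (A i)).
Qed.

Lemma rootF_period k l : contracting l -> iter #|{: endo H}|`! (rootF k) l = l.
Proof.
move=> lc.
have S1 : 1 \in bicomm l by apply/bicommP=> f _; exact: commr1.
have stab : {homo cofactor k l : g / g \in bicomm l}.
  by move=> g; exact: cofactor_bicomm.
have inS j : iter j (cofactor k l) 1 \in bicomm l.
  by elim: j => //= j IH; exact: stab.
have E j : iter j (rootF k) l = l * iter j (cofactor k l) 1.
  elim: j => [|j IH]; first by rewrite /= mulr1.
  by rewrite !iterS IH rootF_cofactor //; apply/(bicommP _ _ (inS j))/commr_refl.
by rewrite E (iter_fact_card stab (cofactor_inj lc)) // mulr1.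
Qed.

Lemma iter_rootF k j l : contracting l -> contracting (iter j (rootF k) l).
Proof. by move=> lc; elim: j => //= j; exact: rootF_contracting. Qed.

Lemma iter_rootF_pred k l : contracting l ->
  iter (#|{: endo H}|`!).-1 (rootF k) (rootF k l) = l.
Proof. by move=> lc; rewrite -iterSr prednK ?fact_gt0 // rootF_period. Qed.

Lemma cong_iter_rootF k i j l l' : contracting l -> contracting l' ->
  l *+ p ^ i = l' *+ p ^ i ->
  iter j (rootF k) l *+ p ^ i = iter j (rootF k) l' *+ p ^ i.
Proof.
move=> lc lc' ll'; elim: j => [|j IH]; first exact: ll'.
rewrite 2!iterS; exact: cong_rootF (iter_rootF _ _ lc) (iter_rootF _ _ lc') IH.
Qed.

Lemma rootF_cong_inj k i l l' : contracting l -> contracting l' ->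
  rootF k l *+ p ^ i = rootF k l' *+ p ^ i -> l *+ p ^ i = l' *+ p ^ i.
Proof.
move=> lc lc' FF.
rewrite -(iter_rootF_pred k lc) -(iter_rootF_pred k lc').
by apply: cong_iter_rootF FF; exact: rootF_contracting.
Qed.

End Operator.

Section Transfer.
Variables (H H' : finZmodType) (phi : {additive H -> H'}).
Variables (l : endo H) (l' : endo H').
Hypotheses (lc : contracting l) (lc' : contracting l').
Hypothesis phil : forall x, phi (l x) = l' (phi x).

Lemma transfer_exp (g : endo H) (g' : endo H') e :
  (forall x, phi (g x) = g' (phi x)) ->
  forall x, phi ((g ^+ e) x) = (g' ^+ e) (phi x).
Proof.
move=> gg' x; elim: e => [|e IH]; first by rewrite !expr0 !endo1.
by rewrite !exprS !endoM gg' IH.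
Qed.

Lemma transfer_divpow x : phi (divpow l x) = divpow l' (phi x).
Proof.
have [z zE] := lc.1 x; rewrite (divpowE lc zE) (transfer_exp _ phil).
by rewrite (divpowE (z := phi z) lc') // -(transfer_exp _ phil) zE raddfMn.
Qed.

Lemma transfer_rootU k x : phi (rootU k l x) = rootU k l' (phi x).
Proof.
rewrite !endo_sum raddf_sum; apply: eq_bigr => i _ /=.
rewrite !endoMn raddfMn !endoM (transfer_exp _ phil); congr (_ *+ _).
by congr (endo_app _ _); exact: transfer_exp transfer_divpow _.
Qed.

Lemma transfer_rootF k x : phi (rootF k l x) = rootF k l' (phi x).
Proof. by rewrite !endoM phil transfer_rootU. Qed.

End Transfer.
End Calculus.

(** * Powers in the multiplicative group of a brace *)

Lemma sum_exp_binomial (R : pzRingType) (x : R) N :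
  \sum_(i < N) (1 + x) ^+ i = \sum_(i < N) x ^+ i *+ 'C(N, i.+1).
Proof.
elim: N => [|N IH]; first by rewrite !big_ord0.
rewrite big_ord_recr /= IH [1 + x]addrC exprD1n.
under [RHS]eq_bigr do rewrite binS mulrnDr.
by rewrite big_split /= [X in _ = X + _]big_ord_recr /= bin_small // mulr0n addr0.
Qed.

Lemma quarter_gt0 p : prime p -> (3 < p)%N -> (0 < (p - 1) %/ 4)%N.
Proof.
move=> p_pr p_gt3; have : p != 4 by apply/eqP=> E; move: p_pr; rewrite E.
by rewrite divn_gt0 //; move: p_gt3; lia.
Qed.

Lemma quarter_le p : (4 * ((p - 1) %/ 4) <= p.-1)%N.
Proof. by rewrite mulnC -subn1 leq_trunc_div. Qed.

Section BraceOperators.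
Variables (p n : nat) (G : finZmodType) (B : brace G).
Hypotheses (p_pr : prime p) (p_gt3 : (3 < p)%N).
Hypothesis Gpn : forall x : G, x *+ p ^ n = 0.
Hypotheses (B1 : property1' p B) (B2 : property1'' p B).
Local Notation m := ((p - 1) %/ 4)%N.

Let m_gt0 := quarter_gt0 p_pr p_gt3.
Let m_le := quarter_le p.

Lemma circ0 a : B a 0 = a.
Proof.
by have /eqP := brace_distr B a 0 0; rewrite addr0 (inj_eq (addrI _)) => /eqP <-.
Qed.

Lemma circ_unit0 : circ_unit B = 0.
Proof. by rewrite -[LHS]circ0 circ1a. Qed.

Lemma starD a : {morph star B a : b c / b + c}.
Proof.
move=> b c; have E := brace_distr B a b c; rewrite /star opprD !addrA.
rewrite -[B a (b + c)](addrK a) E.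
by rewrite [RHS](ACl (1*4*2*5*3*6)).
Qed.

Definition staro a : endo G := mk_endo (starD a).

Lemma staroE a b : staro a b = star B a b. Proof. exact: mk_endoE. Qed.

Lemma circE a b : B a b = a + b + staro a b.
Proof. 
by rewrite staroE /star !addrA [RHS](ACl (3*(1*4)*(2*5))) /= !subrr !addr0. Qed.

Lemma staro_circ a b : staro (B a b) = staro a + staro b + staro a * staro b.
Proof.
apply: endoP=> c; rewrite !endoE; apply: (addrI (B a b + c)).
rewrite -circE -circA circE [B b c]circE [B a b]circE !appD !addrA.
by rewrite [LHS](ACl (1*2*5*3*6*4*7)).
Qed.


Lemma staro0 : staro 0 = 0.
Proof.
apply: endoP=> c; apply: (addrI (0 + c)).
by rewrite -circE endo0 addr0 add0r -circ_unit0 circ1a.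
Qed.

Lemma staro_contracting a : contracting p m (staro a).
Proof.
have itE x : (staro a ^+ m) x = iter m (star B a) x.
  by rewrite endoX; apply: eq_iter => y; exact: staroE.
split=> [x|i c ci]; first by rewrite itE; exact: (B1.1).
have := @B2 a i.+1 c isT. rewrite !inE -itE (subn1 i.+1). 
by move=> h; apply/eqP/h/eqP.
Qed.

(** Powers for the circle operation, whose neutral element is [0]. *)
Definition cpow a N := iter N (B a) 0.

Lemma staro_cpow a N : staro (cpow a N) = (1 + staro a) ^+ N - 1.
Proof.
elim: N => [|N IH]; first by rewrite expr0 subrr staro0.
rewrite /cpow iterS -/(cpow a N) staro_circ IH exprS mulrDl mul1r mulrBr mulr1.
by rewrite !addrA [LHS](ACl (2*4*3*(1*5))) /= subrr addr0.
Qed.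

Lemma cpowE a N : cpow a N = (\sum_(i < N) (1 + staro a) ^+ i) a.
Proof.
elim: N => [|N IH]; first by rewrite big_ord0 endo0.
rewrite /cpow iterS -/(cpow a N) circE IH big_ord_recl expr0.
under [in RHS]eq_bigr do rewrite exprS.
by rewrite -mulr_sumr mulrDl mul1r !endoE addrA.
Qed.

Lemma cpow_root a k : cpow a (p ^ k) = rootU p m k (staro a) a *+ p ^ k.
Proof.
rewrite cpowE sum_exp_binomial -(rootU_p p_pr m_gt0 m_le k (staro_contracting a)).
by rewrite endoMn.
Qed.

(** An element [c] of [ann (p ^ i)] has [p ^ i]-th circle power
    [p ^ i U (L c) c = U (L c) (p ^ i c) = 0]; so [p ^ i L c U (L c) = 0], where
    [U (L c)] is invertible. *)
Lemma staro_ann c i : c *+ p ^ i = 0 -> staro c *+ p ^ i = 0.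
Proof.
move=> ci; have Lc := staro_contracting c.
have : staro (cpow c (p ^ i)) = 0 by rewrite cpow_root -appMn ci app0 staro0.
rewrite staro_cpow -(rootF_p p_pr m_gt0 m_le i Lc) /rootF => F0.
have [V VU] := rootU_inv p_pr m_gt0 m_le Gpn i Lc.
have cU : GRing.comm (staro c) (rootU p m i (staro c)).
  by apply: rootU_comm => //; exact: commr_refl.
rewrite -[LHS]mul1r -VU -mulrA mulrnAr -(mulr0 V); congr (_ * _).
by rewrite -cU.
Qed.

Lemma circVI a : exists a', (1 + staro a) * (1 + staro a') = 1 /\
                            (1 + staro a') * (1 + staro a) = 1.
Proof.
exists (circ_inv B a).
have E b c : (1 + staro b) * (1 + staro c) = 1 + staro (B b c).
  by rewrite staro_circ mulrDl mul1r mulrDr mulr1 !addrA (ACl (1*3*2*4)).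
by rewrite !E circVa circaV circ_unit0 staro0 addr0.
Qed.

Lemma staro_cong a a' i :
  (a - a') *+ p ^ i = 0 -> staro a *+ p ^ i = staro a' *+ p ^ i.
Proof.
move=> aa'; have [b [ab ba]] := circVI a'.
pose c := (1 + staro b) (a - a').
have -> : a = B a' c.
  have : (1 + staro a') c = a - a' by rewrite /c -endoM ab endo1.
  by rewrite endoD endo1 circE -addrA => ->; rewrite addrC subrK.
have c0 : staro c *+ p ^ i = 0.
  by apply: staro_ann; rewrite /c -appMn aa' app0.
by rewrite staro_circ 2!mulrnDl c0 -mulrnAr c0 mulr0 !addr0.
Qed.

(** Equal powers have congruent [rootF] modulo [ann (p ^ i)]; inverting [rootF]
    makes the operators congruent, then their [rootU], which is invertible. *)
Lemma cpow_inj_ann x y i :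
  cpow x (p ^ i) = cpow y (p ^ i) -> x *+ p ^ i = y *+ p ^ i.
Proof.
move=> xy; have Lx := staro_contracting x; have Ly := staro_contracting y.
have LL : staro x *+ p ^ i = staro y *+ p ^ i.
  apply: (rootF_cong_inj p_pr m_gt0 m_le Gpn (k := i) Lx Ly).
  have Fx := rootF_p p_pr m_gt0 m_le i Lx.
  have Fy := rootF_p p_pr m_gt0 m_le i Ly.
  by rewrite [LHS]Fx [RHS]Fy -(staro_cpow x) -(staro_cpow y) xy.
have UU := cong_rootU i Lx Ly LL.
have [V VU] := rootU_inv p_pr m_gt0 m_le Gpn i Lx.
rewrite -[x *+ _]endo1 -[y *+ _]endo1 -VU !endoM; congr (endo_app _ _).
rewrite [LHS]appMn [RHS]appMn -[LHS]cpow_root xy [LHS]cpow_root.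
by rewrite -[LHS]endoMn -UU endoMn.
Qed.

(** The [p ^ i]-th circle powers lie in [p ^ i G], and by [cpow_inj_ann] there
    are at least as many of them as elements of [p ^ i G]. *)
Lemma mulp_is_cpow x i : exists w, cpow w (p ^ i) = x *+ p ^ i.
Proof.
pose f w := cpow w (p ^ i); pose g (w : G) := w *+ p ^ i.
have sub : f @: setT \subset g @: setT.
  by apply/subsetP=> _ /imsetP [w _ ->]; apply/imsetP; eexists; last exact: cpow_root.
pose back u := g (odflt 0 [pick w | f w == u]).
have backE w : back (f w) = g w.
  rewrite /back; case: pickP => [w' /eqP /cpow_inj_ann //|/(_ w)].
  by rewrite eqxx.
have le : (#|g @: [set: G]| <= #|f @: [set: G]|)%N.
  apply: leq_trans (leq_imset_card back _); apply/subset_leq_card/subsetP.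
  move=> _ /imsetP [w _ ->]; apply/imsetP; exists (f w); first exact: imset_f.
  by rewrite backE.
have /eqP fg : f @: setT == g @: setT by rewrite eqEcard sub le.
have : g x \in f @: setT by rewrite fg imset_f.
by case/imsetP=> w _ gE; exists w; exact: esym gE.
Qed.

Lemma staro_mulp x i : exists w, cpow w (p ^ i) = x *+ p ^ i /\
  staro (x *+ p ^ i) = rootF p m i (staro w) *+ p ^ i.
Proof.
have [w wE] := mulp_is_cpow x i; exists w; split=> //.
have Fw := rootF_p p_pr m_gt0 m_le i (staro_contracting w).
by rewrite [RHS]Fw -(staro_cpow w) wE.
Qed.

End BraceOperators.

(** * Quotients by torsion ideals *)

Definition countquot (G : finZmodType) N : countType :=
  HB.pack_for countType (quot_ann G N) (CanIsCountable (@reprK G (quot_ann G N))).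

(** Endomorphism rings are formed on finite groups; the underlying group is
    convertible to [quot_ann G N]. *)
Definition finquot (G : finZmodType) N : finZmodType :=
  HB.pack_for finZmodType (quot_ann G N) (Countable.class (countquot G N))
    (CanIsFinite (@reprK G (quot_ann G N) : @cancel G (countquot G N) _ _)).

Section FinQuot.
Variables (G : finZmodType) (N : nat).
Local Notation P := (finquot G N).

Definition qpi : G -> P := \pi_(quot_ann G N).
Definition qrepr : P -> G := fun x => repr (x : quot_ann G N).

Lemma qreprK x : qpi (qrepr x) = x. Proof. exact: reprK. Qed.

Lemma qpi_zmod : zmod_morphism qpi.
Proof. by move=> a b; exact: (raddfB \pi_(quot_ann G N)). Qed.

HB.instance Definition _ := GRing.isZmodMorphism.Build G P qpi qpi_zmod.

Lemma qpiP (a b : G) : reflect (qpi a = qpi b) ((a - b) *+ N == 0).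
Proof.
have -> : ((a - b) *+ N == 0) = (a - b \in ann N) by rewrite inE.
by rewrite Quotient.idealrBE; exact: eqP.
Qed.

Lemma qrepr_pi a : (qrepr (qpi a) - a) *+ N = 0.
Proof. by apply/eqP/qpiP; rewrite qreprK. Qed.

Lemma induced_subproof (l : endo G) :
  {morph (fun x : P => qpi (l (qrepr x))) : x y / x + y}.
Proof.
move=> x y /=; rewrite -raddfD -appD; apply/qpiP.
rewrite -appB -appMn; apply/eqP; rewrite -[RHS](app0 l); congr (l _).
by apply/eqP/qpiP; rewrite raddfD /= !qreprK.
Qed.

Definition induced (l : endo G) : endo P := mk_endo (induced_subproof l).

Lemma inducedE (l : endo G) a : induced l (qpi a) = qpi (l a).
Proof.
rewrite mk_endoE; apply/qpiP; rewrite -appB -appMn.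
by rewrite qrepr_pi app0.
Qed.

Lemma induced_exp (l : endo G) e a : (induced l ^+ e) (qpi a) = qpi ((l ^+ e) a).
Proof. by elim: e => [|e IH]; rewrite ?expr0 ?endo1 // !exprS !endoM IH inducedE. Qed.

End FinQuot.

(** The torsion of the quotient by [ann (p ^ r)] is the torsion of [G] shifted
    by [r]. *)
Lemma induced_contracting (p m r : nat) (G : finZmodType) (l : endo G) :
  contracting p m l -> contracting p m (induced (p ^ r) l).
Proof.
move=> [lp lann]; split=> [x|i c].
  rewrite -(qreprK x) induced_exp; have [z ->] := lp (qrepr x).
  by exists (qpi _ z); rewrite raddfMn.
rewrite -(qreprK c) induced_exp; set a := qrepr c.
rewrite -2!raddfMn -(raddf0 (qpi (p ^ r))) => /qpiP; rewrite subr0 => /eqP ai.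
apply/qpiP; rewrite subr0 -mulrnA -expnD.
by rewrite lann // -addSn expnD mulrnA ai.
Qed.

(** * The operation odot on the quotient *)

Section Odot.
Variables (p n k : nat) (G : finZmodType) (B : brace G) (winv : G -> G).
Hypotheses (p_pr : prime p) (p_gt3 : (3 < p)%N).
Hypothesis Gpn : forall x : G, x *+ p ^ n = 0.
Hypotheses (B1 : property1' p B) (B2 : property1'' p B).
Hypothesis winvK : division_fun (p ^ k) winv.
Local Notation m := ((p - 1) %/ 4)%N.
Local Notation N := (p ^ (2 * k))%N.
Local Notation P := (finquot G N).
Local Notation pi := (qpi N).

Let pN (x : G) : x *+ p ^ k *+ p ^ k = x *+ N.
Proof. by rewrite -mulrnA -expnD addnn mul2n. Qed.

Definition dot : P -> P -> P := odot p k B winv.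

(** Besides its use for computing [dot], this contains that [odot] is well
    defined: the choice of representatives is immaterial because [ann (p ^ k)]
    is an ideal and [p ^ k G * G] lies in [p ^ k G]. *)
Lemma dot_pi a b d :
  (d *+ p ^ k - staro B (a *+ p ^ k) b) *+ p ^ k = 0 -> dot (pi a) (pi b) = pi d.
Proof.
move=> dE; rewrite /dot /odot; unlock => /=.
set a' := repr _; set b' := repr _.
have a'a : (a' - a) *+ N = 0 by exact: qrepr_pi.
have b'b : (b' - b) *+ N = 0 by exact: qrepr_pi.
apply/qpiP/eqP.
set s := star _ _ _; have sE : s = staro B (a' *+ p ^ k) b' by rewrite staroE.
have [w' [_ Fw']] := staro_mulp p_pr p_gt3 Gpn B1 B2 a' k.
have [w [_ Fw]] := staro_mulp p_pr p_gt3 Gpn B1 B2 a k.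
have ws : winv s *+ p ^ k = s.
  by apply: winvK; rewrite sE Fw' endoMn; eexists.
have LL : staro B (a' *+ p ^ k) *+ p ^ k = staro B (a *+ p ^ k) *+ p ^ k.
  by apply: (staro_cong p_pr p_gt3 Gpn B1 B2); rewrite -mulrnBl pN a'a.
have sS : s *+ p ^ k = staro B (a *+ p ^ k) b *+ p ^ k.
  rewrite sE -[LHS]endoMn LL endoMn; apply/eqP; rewrite -subr_eq0 -mulrnBl -appB.
  by rewrite Fw endoMn -!appMn pN b'b app0.
by rewrite -pN mulrnBl ws mulrnBl sS -opprB -mulrnBl dE oppr0.
Qed.

Lemma dotP a b : exists2 d,
  d *+ p ^ k = staro B (a *+ p ^ k) b & dot (pi a) (pi b) = pi d.
Proof.
have [w [_ Fw]] := staro_mulp p_pr p_gt3 Gpn B1 B2 a k.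
have dE : rootF p m k (staro B w) b *+ p ^ k = staro B (a *+ p ^ k) b.
  by rewrite Fw endoMn.
by exists (rootF p m k (staro B w) b) => //; apply: dot_pi; rewrite dE subrr mul0rn.
Qed.

Lemma dotD x : {morph dot x : y z / y + z}.
Proof.
move=> y z; rewrite -(qreprK x) -(qreprK y) -(qreprK z) -raddfD.
have [d dE ->] := dotP (qrepr x) (qrepr y).
have [e eE ->] := dotP (qrepr x) (qrepr z).
by rewrite -raddfD; apply: dot_pi;
  rewrite appD [(d + e) *+ _]mulrnDl dE eE subrr mul0rn.
Qed.

Definition doto (x : P) : endo P := mk_endo (dotD x).

Lemma dotoE x y : doto x y = dot x y. Proof. exact: mk_endoE. Qed.

Lemma doto0 : doto 0 = 0.
Proof.
apply: endoP=> y; rewrite endo0 dotoE -(qreprK y) -!(raddf0 pi).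
by apply: dot_pi; rewrite !mul0rn staro0 endo0 subr0 mul0rn.
Qed.

(** The circle operation of [p ^ k G], transported to the quotient by
    [x |-> p ^ k x]. *)
Lemma doto_circ x y :
  doto (x + y + doto x y *+ p ^ k) = doto x + doto y + (doto x * doto y) *+ p ^ k.
Proof.
apply: endoP=> z; rewrite !(endoE, dotoE).
rewrite -(qreprK x) -(qreprK y) -(qreprK z).
set a := qrepr x; set b := qrepr y; set c := qrepr z.
have [d dE ->] := dotP a b; have [e eE ->] := dotP a c.
have [f fE ->] := dotP b c; have [g gE ->] := dotP a f.
rewrite -!raddfMn -!raddfD; apply: dot_pi; apply/eqP.
have -> : (a + b + d *+ p ^ k) *+ p ^ k = B (a *+ p ^ k) (b *+ p ^ k).
  by rewrite (circE B) !mulrnDl appMn dE.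
have -> : (e + f + g *+ p ^ k) *+ p ^ k = staro B (B (a *+ p ^ k) (b *+ p ^ k)) c.
  by rewrite staro_circ !endoE -fE !mulrnDl eE gE appMn.
by rewrite subrr mul0rn.
Qed.

Lemma doto_mulp x z j : exists w, doto (x *+ p ^ j) z = w *+ p ^ j.
Proof.
rewrite dotoE -(qreprK x) -(qreprK z) -raddfMn.
set a := qrepr x; set c := qrepr z.
have [w [_ Fw]] := staro_mulp p_pr p_gt3 Gpn B1 B2 a (j + k).
exists (pi (rootF p m (j + k) (staro B w) c)).
rewrite -raddfMn; apply: dot_pi.
by rewrite -!mulrnA -expnD Fw endoMn subrr mul0rn.
Qed.

Definition qstaro (x : P) : endo P := induced N (staro B (qrepr x)).

Lemma qstaro_contracting x : contracting p m (qstaro x).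
Proof. by apply: induced_contracting; exact: staro_contracting. Qed.

(** [p ^ k (U (L x) x)] is the [p ^ k]-th circle power of [x], whose operator is
    [p ^ k F (L x)]; dividing by [p ^ k] gives [doto] of its argument. *)
Lemma doto_root x : doto (rootU p m k (qstaro x) x) = rootF p m k (qstaro x).
Proof.
set a := qrepr x; set L := qstaro x.
have La : contracting p m (staro B a) by exact: staro_contracting.
have Lc : contracting p m L by exact: qstaro_contracting.
have phiL b : pi (staro B a b) = L (pi b) by rewrite inducedE.
have -> : rootU p m k L x = pi (rootU p m k (staro B a) a).
  by rewrite (transfer_rootU La Lc phiL) /= /a qreprK.
apply: endoP=> y; rewrite dotoE -(qreprK y) -(transfer_rootF La Lc phiL).
apply: dot_pi; rewrite -(cpow_root p_pr p_gt3 B1 B2) (staro_cpow B).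
rewrite -(rootF_p p_pr (quarter_gt0 p_pr p_gt3) (quarter_le p) k La).
by rewrite endoMn subrr mul0rn.
Qed.

End Odot.

(** The torsion ideals are ideals of the brace, so that its star operation
    descends to the quotient. *)
Lemma star_quot (p n r : nat) (G : finZmodType) (B : brace G) (a b : G) :
  prime p -> (3 < p)%N -> (forall x : G, x *+ p ^ n = 0) ->
  property1' p B -> property1'' p B ->
  let pi : G -> quot_ann G (p ^ r) := \pi_(quot_ann G (p ^ r)) in
  star (quot_circ B (p ^ r)) (pi a) (pi b) = pi (star B a b).
Proof.
move=> p_pr p_gt3 Gpn B1 B2 pi; rewrite /star /quot_circ; unlock => /=.
set a' := repr (pi a); set b' := repr (pi b).
have a'a : (a' - a) *+ p ^ r = 0 by exact: qrepr_pi.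
have b'b : (b' - b) *+ p ^ r = 0 by exact: qrepr_pi.
have -> : \pi_(quot_ann G (p ^ r)) (B a' b') = pi (B a b).
  apply/qpiP/eqP; rewrite !(circE B).
  have -> : a' + b' + staro B a' b' - (a + b + staro B a b)
      = (a' - a) + (b' - b) + (staro B a' b' - staro B a b).
    by rewrite !opprD !addrA (ACl (1*4*2*5*3*6)).
  rewrite 2!mulrnDl a'a b'b !add0r mulrnBl -[LHS]addr0.
  rewrite -[X in X - _]endoMn (staro_cong p_pr p_gt3 Gpn B1 B2 a'a) endoMn addr0.
  by rewrite -mulrnBl -appB -appMn b'b app0.
by rewrite -!(raddfB \pi_(quot_ann G (p ^ r))).
Qed.

(** * Coefficients of polynomial functions and roots of unity *)

Section Coefficients.
Variables (p n z : nat) (H : finZmodType).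
Hypotheses (p_pr : prime p) (p_gt3 : (3 < p)%N).
Hypothesis Hpn : forall x : H, x *+ p ^ n = 0.
Hypothesis z_order : (z ^ p.-1 = 1 %[mod p ^ n])%N.
Hypothesis z_gt0 : (0 < z)%N.
Hypothesis z_prim : forall e, (z ^ e = 1 %[mod p] -> p.-1 %| e)%N.

Lemma mulrn_mod a b (x : H) : (a = b %[mod p ^ n])%N -> x *+ a = x *+ b.
Proof.
move=> ab; rewrite (divn_eq a (p ^ n)) (divn_eq b (p ^ n)) ab !mulrnDr.
by rewrite ![(_ * p ^ n)%N]mulnC !mulrnA Hpn !mul0rn.
Qed.

Definition unit_inv (d : nat) : nat := (egcdn d (p ^ n)).1.

Lemma unit_invE d (x : H) : coprime d p -> x *+ (d * unit_inv d) = x.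
Proof.
move=> dp; have d_gt0 : (0 < d)%N.
  by case: d dp => //; rewrite /coprime gcd0n => /eqP p1; move: p_pr; rewrite p1.
rewrite /unit_inv; case: egcdnP => //= u v uv _.
have /eqP g1 : coprime d (p ^ n) by rewrite coprimeXr.
rewrite mulnC uv g1 mulrnDr mulnC mulrnA Hpn mul0rn add0r //.
Qed.

Lemma unit_cancel d (x : H) : coprime d p -> x *+ d = 0 -> x = 0.
Proof. by move=> dp x0; rewrite -(unit_invE x dp) mulrnA x0 mul0rn. Qed.

Lemma small_coprime d : (0 < d < p)%N -> coprime d p.
Proof.
by move=> /andP [d0 dp]; rewrite coprime_sym prime_coprime // gtnNdvd.
Qed.

(** Multiplication by [z ^ e] permutes the terms cyclically, and [z ^ e - 1] is
    prime to [p]. *)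
Lemma root_sum (x : H) e : ~~ (p.-1 %| e)%N ->
  \sum_(i < p.-1) x *+ z ^ (i * e) = 0.
Proof.
move=> pe; set y := \sum_(i < p.-1) _.
have ze_gt0 : (0 < z ^ e)%N by rewrite expn_gt0 z_gt0.
have yz : y *+ z ^ e = y.
  rewrite -sumrMnl /y; case: p.-1 z_order => [|M] zo; first by rewrite !big_ord0.
  rewrite big_ord_recr [RHS]big_ord_recl /= addrC; congr (_ + _).
    rewrite -mulrnA -expnD -mulSnr; apply: mulrn_mod.
    by rewrite mul0n expnM -modnXm zo modnXm exp1n.
  by apply: eq_bigr => i _; rewrite -mulrnA -expnD -mulSnr.
have y0 : y *+ (z ^ e).-1 = 0.
  by apply: (addIr y); rewrite add0r -mulrSr prednK.
apply: unit_cancel y0; rewrite coprime_sym prime_coprime //.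
apply: contra pe => pz; apply: z_prim.
by rewrite -(prednK ze_gt0) -addn1 -modnDml (eqP pz).
Qed.

(** The coefficient of [t ^ d] of a function of [t] that is a polynomial of
    degree less than [p - 1]: averaging against a power of the root of unity
    kills all other monomials. *)
Definition coef (d : nat) (f : nat -> H) : H :=
  (\sum_(i < p.-1) f (z ^ i)%N *+ z ^ (i * (p.-1 - d))) *+ unit_inv p.-1.

Let p1_coprime : coprime p.-1 p.
Proof. by apply: small_coprime; have := prime_gt1 p_pr; lia. Qed.

Lemma eq_coef d f g : f =1 g -> coef d f = coef d g.
Proof. by move=> fg; rewrite /coef; under eq_bigr do rewrite fg. Qed.

Lemma coefD d f g : coef d (fun t => f t + g t) = coef d f + coef d g.
Proof.
rewrite /coef -mulrnDl -big_split /=; congr (_ *+ _).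
by apply: eq_bigr => i _; rewrite mulrnDl.
Qed.

Lemma coef_const0 d : coef d (fun=> 0) = 0.
Proof. by rewrite /coef big1 ?mul0rn // => i _; rewrite mul0rn. Qed.

Lemma coef_sum d (I : Type) (r : seq I) (P : pred I) (F : I -> nat -> H) :
  coef d (fun t => \sum_(i <- r | P i) F i t) = \sum_(i <- r | P i) coef d (F i).
Proof.
rewrite /coef; under eq_bigr do rewrite -sumrMnl.
by rewrite exchange_big /= -sumrMnl.
Qed.

Lemma coef_app d (l : endo H) f : coef d (fun t => l (f t)) = l (coef d f).
Proof.
rewrite /coef appMn app_sum; congr (_ *+ _); apply: eq_bigr => i _.
by rewrite appMn.
Qed.

Lemma coef_pow d e (x : H) : (d < p.-1)%N -> (e < p.-1)%N ->
  coef d (fun t => x *+ t ^ e) = if e == d then x else 0.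
Proof.
move=> dp ep; rewrite /coef.
under eq_bigr do rewrite -mulrnA -expnM -expnD -mulnDr.
case: eqP => [->|ed].
  rewrite subnKC 1?ltnW //; under eq_bigr => i _.
    rewrite (@mulrn_mod _ 1%N); first over.
    by rewrite mulnC expnM -modnXm z_order modnXm exp1n.
  by rewrite sumr_const card_ord -mulrnA mulr1n unit_invE.
rewrite root_sum ?mul0rn //; apply/negP=> /dvdnP [c cE].
case: c cE => [|[|c]]; rewrite ?mul0n ?mul1n => cE; [lia | apply: ed; lia |].
have : (2 * p.-1 <= c.+2 * p.-1)%N by rewrite leq_mul2r orbT.
by rewrite -cE; lia.
Qed.

Lemma coef_poly d (c : nat -> H) : (d < p.-1)%N ->
  coef d (fun t => \sum_(e < p.-1) c e *+ t ^ e) = c d.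
Proof.
move=> dp; rewrite coef_sum (bigD1 (Ordinal dp)) //= coef_pow // eqxx.
rewrite big1 ?addr0 // => e ed; rewrite coef_pow //.
by case: eqP => // E; move: ed; rewrite -val_eqE /= E eqxx.
Qed.

End Coefficients.

Arguments eq_coef {p n z H d f} g _.

(** * Slow polynomial functions *)

Section Slow.
Variables (p n q : nat) (H : finZmodType).
Hypotheses (p_pr : prime p) (p_gt3 : (3 < p)%N).
Hypothesis Hpn : forall x : H, x *+ p ^ n = 0.
Hypothesis Hq : forall x : H, x *+ q ^ p.-2 = 0.

Lemma mulq0 e (x : H) : (p.-2 <= e)%N -> x *+ q ^ e = 0.
Proof. by move=> le; rewrite -(subnK le) addnC expnD mulrnA Hq mul0rn. Qed.

(** Functions of two integers generated by monomials in which degree [d.+1]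
    costs a factor [q ^ d]; the powers of [q] that occur are at least [s].  As
    [q ^ (p - 2)] is zero, their degrees are less than [p - 1]. *)
Inductive slow (s : nat) : (nat -> nat -> H) -> Prop :=
| Slow0 f : (forall i j, f i j = 0) -> slow s f
| SlowS w e a b f g : (s <= e)%N -> (a + b <= e.+1)%N -> slow s g ->
    (forall i j, f i j = w *+ (q ^ e * (i ^ a * j ^ b)) + g i j) -> slow s f.

Lemma eq_slow s f g : f =2 g -> slow s f -> slow s g.
Proof.
move=> fg sf; case: sf fg => [f0 f00|w e a b f0 g0 se ab sg fE] fg.
  by apply: Slow0 => i j; rewrite -fg.
by apply: SlowS se ab sg _ => i j; rewrite -fg.
Qed.

Lemma slow_le s s' f : (s' <= s)%N -> slow s f -> slow s' f.
Proof.
move=> ss'; elim=> [f0 f00|w e a b f0 g0 se ab _ IH fE]; first exact: Slow0.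
by apply: SlowS ab IH fE; exact: leq_trans se.
Qed.

Lemma slow_zero s : slow s (fun _ _ => 0). Proof. exact: Slow0. Qed.

Lemma slow_add s f g : slow s f -> slow s g -> slow s (fun i j => f i j + g i j).
Proof.
move=> sf sg; elim: sf => [f0 f00|w e a b f0 g0 se ab _ IH fE].
  by apply: eq_slow sg => i j; rewrite f00 add0r.
by apply: SlowS se ab IH _ => i j; rewrite fE addrA.
Qed.

Lemma slow_sum s (I : Type) (r : seq I) (P : pred I) (F : I -> nat -> nat -> H) :
  (forall t, P t -> slow s (F t)) -> slow s (fun i j => \sum_(t <- r | P t) F t i j).
Proof.
move=> sF; elim: r => [|t r IH].
  by apply: Slow0 => i j; rewrite big_nil.
case Pt: (P t); last by apply: eq_slow IH => i j; rewrite big_cons Pt.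
by apply: eq_slow (slow_add (sF t Pt) IH) => i j; rewrite big_cons Pt.
Qed.

Lemma slow_opp s f : slow s f -> slow s (fun i j => - f i j).
Proof.
elim=> [f0 f00|w e a b f0 g0 se ab _ IH fE].
  by apply: Slow0 => i j; rewrite f00 oppr0.
by apply: (SlowS (w := - w)) se ab IH _ => i j; rewrite fE opprD mulNrn.
Qed.

Lemma slow_sub s f g : slow s f -> slow s g -> slow s (fun i j => f i j - g i j).
Proof. by move=> sf /slow_opp; apply: slow_add. Qed.

Lemma slow_term s w e a b : (s <= e)%N -> (a + b <= e.+1)%N ->
  slow s (fun i j => w *+ (q ^ e * (i ^ a * j ^ b))).
Proof.
by move=> se ab; apply: SlowS se ab (slow_zero s) _ => i j; rewrite addr0.
Qed.

(** For [r < p] the denominator [r!] of ['C(mu, r)] is invertible on [H]; hence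
    the coefficients are taken in [H] rather than in the integers. *)
Lemma binomial_poly r (x : H) : (r < p)%N -> exists y : nat -> H,
  forall mu, x *+ 'C(mu, r) = \sum_(t < r.+1) y t *+ mu ^ t.
Proof.
elim: r x => [|r IH] x rp.
  by exists (fun=> x) => mu; rewrite big_ord1 bin0.
have [y yE] := IH (x *+ unit_inv p n r.+1) (ltnW rp).
exists (fun t =>
  (if t is t'.+1 then y t' else 0) - (if t == r.+1 then 0 else y t *+ r)).
move=> mu; have cop : coprime r.+1 p by apply: small_coprime.
rewrite -[LHS](unit_invE p_pr Hpn _ cop) -mulrnA mulnA mulnC [('C(_, _) * _)%N]mulnC.
rewrite mul_bin_left mulrnA.
have -> : x *+ unit_inv p n r.+1 *+ ((mu - r) * 'C(mu, r)) =
    \sum_(t < r.+1) y t *+ mu ^ t.+1 - \sum_(t < r.+1) y t *+ r *+ mu ^ t.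
  apply: (addIr (\sum_(t < r.+1) y t *+ r *+ mu ^ t)); rewrite subrK.
  under [in LHS]eq_bigr do rewrite mulrnAC.
  under [in RHS]eq_bigr do rewrite expnSr mulrnA.
  rewrite !sumrMnl -yE; set X := x *+ _.
  rewrite -(mulrnA X) -(mulrnA X) -mulrnDr; congr (X *+ _).
  case: (ltnP mu r) => [mur|rmu]; first by rewrite bin_small ?muln0.
  by rewrite [('C(_, _) * r)%N]mulnC -mulnDl subnK // mulnC.
under [RHS]eq_bigr do rewrite mulrnBl.
rewrite big_split /= sumrN [X in _ = X + _]big_ord_recl mul0rn add0r; congr (_ - _).
rewrite [RHS]big_ord_recr /= eqxx mul0rn addr0; apply: eq_bigr => t _.
by rewrite ltn_eqF.
Qed.

Lemma slow_binom s w E c r a b a' b' :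
  (r < p)%N -> (s <= E)%N -> (r * (a + b) + (a' + b') <= E.+1)%N ->
  slow s (fun i j => w *+ (q ^ E * ('C(c * (i ^ a * j ^ b), r) * (i ^ a' * j ^ b')))).
Proof.
move=> rp sE ab; have [y yE] := binomial_poly w rp.
have: slow s (fun i j => \sum_(t < r.+1)
   y t *+ c ^ t *+ (q ^ E * (i ^ (a * t + a') * j ^ (b * t + b')))).
  apply: slow_sum => t _; apply: slow_term => //.
  apply: leq_trans ab; rewrite addnACA -mulnDl leq_add2r mulnC leq_mul2r.
  by rewrite -ltnS ltn_ord orbT.
apply: eq_slow => i j; rewrite mulnCA [RHS]mulrnA yE -sumrMnl.
apply: eq_bigr => t _; rewrite -!mulrnA; congr (_ *+ _).
by rewrite !expnMn !expnD !expnM; lia.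
Qed.


(** * Operators of a group law are slow polynomials *)

(** [D x y] stands for the product [x odot y] and [q] for [p ^ k]: the map
    [x |-> 1 + q D x] is a morphism for the group law [x + y + q D x y]. *)
Record flow_law (D : H -> endo H) : Prop := FlowLaw {
  flow0 : D 0 = 0;
  flow_circ : forall x y,
    D (x + y + D x y *+ q) = D x + D y + (D x * D y) *+ q;
  flow_mulq : forall x e y, exists w, D (x *+ q ^ e) y = w *+ q ^ e
}.

Variable D : H -> endo H.
Hypothesis law : flow_law D.

Definition lam x : endo H := 1 + D x *+ q.

Lemma lamE x y : lam x y = y + D x y *+ q.
Proof. by rewrite endoD endo1 endoMn. Qed.

Lemma flow_add x y : D (x + lam x y) = D x + lam x * D y.
Proof.
by rewrite lamE addrA (flow_circ law) /lam mulrDl mul1r mulrnAl addrA.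
Qed.

Lemma lam_add x y : lam (x + lam x y) = lam x * lam y.
Proof.
rewrite {1}/lam flow_add {3}/lam mulrDr mulr1 mulrnAr mulrnDl addrA.
by rewrite -/(lam x).
Qed.

Lemma exp_flow_mulq y e r x :
  exists w, (D (y *+ q ^ e) ^+ r) x = w *+ q ^ (e * r).
Proof.
elim: r => [|r [w wE]]; first by exists x; rewrite muln0 expr0 endo1.
have [v vE] := flow_mulq law y e w.
by exists v; rewrite exprS endoM wE appMn vE -mulrnA mulnS expnD.
Qed.

(** Powers in the group law [x + lam x y]. *)
Definition fpow y mu : H := (\sum_(i < mu) lam y ^+ i) y.

Lemma fpowS y mu : fpow y mu.+1 = y + lam y (fpow y mu).
Proof.
rewrite /fpow big_ord_recl expr0 endoD endo1; congr (_ + _).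
by under eq_bigr do rewrite exprS; rewrite -mulr_sumr endoM.
Qed.

Lemma flow_fpow y mu : D (fpow y mu) = (\sum_(i < mu) lam y ^+ i) * D y.
Proof.
elim: mu => [|mu IH].
  by rewrite /fpow !big_ord0 endo0 mul0r (flow0 law).
rewrite fpowS flow_add IH [in RHS]big_ord_recl expr0 [RHS]mulrDl mul1r; congr (_ + _).
by under [in RHS]eq_bigr do rewrite exprS; rewrite -mulr_sumr mulrA.
Qed.

Lemma lam_fpow y mu : lam (fpow y mu) = lam y ^+ mu.
Proof.
elim: mu => [|mu IH]; last by rewrite fpowS lam_add IH exprS.
by rewrite /fpow big_ord0 endo0 /lam (flow0 law) mul0rn addr0 expr0.
Qed.

Lemma endo_mulq0 (f : endo H) e : (p.-2 <= e)%N -> f *+ q ^ e = 0.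
Proof. by move=> le; apply: endoP=> x; rewrite endoMn mulq0 // endo0. Qed.

Lemma lam_exp y mu : lam y ^+ mu =
  \sum_(r < p.-2) D y ^+ r *+ (q ^ r * 'C(mu, r)).
Proof.
have trunc K : (\sum_(r < p.-2 + K) D y ^+ r *+ (q ^ r * 'C(mu, r)) =
    \sum_(r < p.-2) D y ^+ r *+ (q ^ r * 'C(mu, r))).
  rewrite big_split_ord /= [X in _ + X]big1 ?addr0 // => r _.
  by rewrite mulrnA endo_mulq0 ?mul0rn // leq_addr.
rewrite -(trunc mu.+1) addnC big_split_ord /= [X in _ + X]big1 ?addr0; last first.
  by move=> r _; rewrite bin_small ?muln0 // addSn ltnS leq_addr.
rewrite /lam addrC exprD1n; apply: eq_bigr => r _.
by rewrite exprMn_n -mulrnA.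
Qed.

Lemma sum_lam_exp y mu : \sum_(i < mu) lam y ^+ i =
  \sum_(r < p.-2) D y ^+ r *+ (q ^ r * 'C(mu, r.+1)).
Proof.
have trunc K : (\sum_(r < p.-2 + K) D y ^+ r *+ (q ^ r * 'C(mu, r.+1)) =
    \sum_(r < p.-2) D y ^+ r *+ (q ^ r * 'C(mu, r.+1))).
  rewrite big_split_ord /= [X in _ + X]big1 ?addr0 // => r _.
  by rewrite mulrnA endo_mulq0 ?mul0rn // leq_addr.
rewrite -(trunc mu) addnC big_split_ord /= [X in _ + X]big1 ?addr0; last first.
  by move=> r _; rewrite bin_small ?muln0 // ltnS leq_addr.
rewrite /lam sum_exp_binomial; apply: eq_bigr => r _.
by rewrite exprMn_n -mulrnA.
Qed.

(** The inverse of [lam y] is thus a power with positive exponent, to which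
    the binomial expansion [lam_exp] applies. *)
Lemma lam_period y : lam y ^+ (p ^ n) = 1.
Proof.
have : (0 < p.-2)%N by lia.
case E: p.-2 => [//|M] _; rewrite lam_exp E big_ord_recl /= expr0 bin0 mul1n.
rewrite big1 ?addr0 // => r _.
have rp : (r.+1 < p)%N by have := ltn_ord r; move: E p_gt3; lia.
have /dvdnP [c ->] : (p ^ n %| 'C(p ^ n, r.+1))%N.
  rewrite -(Gauss_dvdr _ (n := r.+1)).
    by rewrite -mul_bin_diag dvdn_mulr.
  by rewrite coprime_sym coprimeXr // small_coprime.
by apply: endoP=> x; rewrite mulnA mulnC endoMn mulrnA Hpn mul0rn endo0.
Qed.

Let M_gt0 : (0 < p.-2)%N. Proof. by lia. Qed.

(** Each application of [D (w *+ q ^ e)] brings a factor [q ^ e], so that a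
    binomial coefficient of rank [r] in [i ^ a * j ^ b], of degree at most
    [r * e.+1], comes with [q ^ (r * e.+1)]. *)
Lemma slow_lam_sub w e a b c f : (a + b <= e.+1)%N -> slow 0 f ->
  slow e.+1 (fun i j =>
    (lam (w *+ q ^ e) ^+ (c * (i ^ a * j ^ b))) (f i j) - f i j).
Proof.
move=> ab; set y := w *+ _; elim=> [f0 f00|v e' a' b' f0 g0 _ ab' _ IH fE].
  by apply: Slow0 => i j; rewrite f00 app0 subr0.
have sv : slow e.+1 (fun i j =>
    ((lam y ^+ (c * (i ^ a * j ^ b))) v - v) *+ (q ^ e' * (i ^ a' * j ^ b'))).
  case ME: p.-2 M_gt0 => [//|M] _.
  have: slow e.+1 (fun i j => \sum_(r < M) (D y ^+ r.+1) v
      *+ (q ^ r.+1 * 'C(c * (i ^ a * j ^ b), r.+1)) *+ (q ^ e' * (i ^ a' * j ^ b'))).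
    apply: slow_sum => r _.
    have rp : (r.+1 < p)%N by have := ltn_ord r; move: ME p_gt3; lia.
    have [v' v'E] := exp_flow_mulq w e r.+1 v.
    have sr : (r.+1 * (a + b) + (a' + b') <= (e * r.+1 + r.+1 + e').+1)%N.
      by nia.
    apply: eq_slow (slow_binom v' c rp _ sr); last by nia.
    move=> i j; rewrite v'E -!mulrnA; congr (_ *+ _).
    by rewrite !expnD; lia.
  apply: eq_slow => i j; rewrite sumrMnl; congr (_ *+ _).
  rewrite lam_exp ME big_ord_recl expr0 bin0 endoD endo1 addrC addKr endo_sum.
  by apply: eq_bigr => r _; rewrite endoMn.
apply: eq_slow (slow_add sv IH) => i j.
by rewrite fE appD appMn mulrnBl opprD addrACA.
Qed.

Lemma slow_fpow w e a b : (a + b <= e.+1)%N ->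
  slow e.+1 (fun i j => fpow (w *+ q ^ e) (i ^ a * j ^ b)
                        - w *+ q ^ e *+ (i ^ a * j ^ b)).
Proof.
move=> ab; set y := w *+ _; case ME: p.-2 M_gt0 => [//|M] _.
have: slow e.+1 (fun i j => \sum_(r < M) (D y ^+ r.+1) y
    *+ (q ^ r.+1 * 'C(i ^ a * j ^ b, r.+2))).
  apply: slow_sum => r _.
  have rp : (r.+2 < p)%N by have := ltn_ord r; move: ME p_gt3; lia.
  have [v' v'E] := exp_flow_mulq w e r.+1 w.
  have sr : (r.+2 * (a + b) + (0 + 0) <= (e * r.+1 + e + r.+1).+1)%N by nia.
  apply: eq_slow (slow_binom v' 1 rp _ sr); last by nia.
  move=> i j; rewrite {2}/y appMn v'E -!mulrnA; congr (_ *+ _).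
  by rewrite !expnD !expn0 mul1n !muln1; lia.
apply: eq_slow => i j; rewrite /fpow sum_lam_exp ME big_ord_recl expr0 mul1n bin1.
rewrite endoD endoMn endo1 addrC addKr endo_sum.
by apply: eq_bigr => r _; rewrite endoMn.
Qed.

Lemma slow_flow_fpow w e a b h : (a + b <= e.+1)%N ->
  slow 0 (fun i j => D (fpow (w *+ q ^ e) (i ^ a * j ^ b)) h).
Proof.
move=> ab; set y := w *+ _.
have: slow 0 (fun i j => \sum_(r < p.-2) (D y ^+ r.+1) h
    *+ (q ^ r * 'C(i ^ a * j ^ b, r.+1))).
  apply: slow_sum => r _.
  have rp : (r.+1 < p)%N by have := ltn_ord r; move: p_gt3; lia.
  have [v' v'E] := exp_flow_mulq w e r.+1 h.
  have sr : (r.+1 * (a + b) + (0 + 0) <= (e * r.+1 + r).+1)%N by nia.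
  apply: eq_slow (slow_binom v' 1 rp _ sr) => // i j.
  rewrite v'E -!mulrnA; congr (_ *+ _).
  by rewrite !expnD !expn0 mul1n !muln1; lia.
apply: eq_slow => i j; rewrite flow_fpow sum_lam_exp mulr_suml endo_sum.
by apply: eq_bigr => r _; rewrite mulrnAl -exprSr endoMn.
Qed.

(** Descending induction on the level [s]: a term [w q^e i^a j^b] of [g] is
    split off as the power of exponent [i^a j^b] of [y = w q^e] in the group
    law, up to terms of higher level.  The operator of this power is a binomial
    sum, and the remaining factor [R] has one term less at level [s]. *)
Lemma slow_flow_le s g h : slow s g -> slow 0 (fun i j => D (g i j) h).
Proof.
have [t st] : exists t, (p.-2 <= s + t)%N by exists p.-2; rewrite leq_addl.
elim: t s st g h => [|t IH] s st g h sg.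
  apply: Slow0 => i j; suff -> : g i j = 0 by rewrite (flow0 law) endo0.
  rewrite addn0 in st.
  elim: sg => [f0 ->//|w e a b f0 g0 se _ _ IH ->].
  by rewrite IH addr0 mulrnA mulq0 ?mul0rn // (leq_trans st).
suff H0 g' : slow s.+1 g' -> slow 0 (fun i j => D (g i j + g' i j) h).
  apply: eq_slow (H0 _ (slow_zero _)) => i j; by rewrite addr0.
elim: sg g' => [f0 f00|w e a b f0 g0 se ab sg0 IHg fE] g' sg'.
  have st' : (p.-2 <= s.+1 + t)%N by rewrite addSnnS.
  by apply: eq_slow (IH _ st' _ h sg') => i j; rewrite f00 add0r.
(* [R] solves [g + g' = fpow y mu + lam (fpow y mu) R]. *)
pose y := w *+ q ^ e; pose mu i j := (i ^ a * j ^ b)%N.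
pose c := (p ^ n).-1.
pose d i j := fpow y (mu i j) - y *+ mu i j.
have sd : slow s.+1 d by apply: slow_le (slow_fpow w ab); rewrite ltnS.
pose u i j := g0 i j + (g' i j - d i j).
have su : slow s u.
  by apply: slow_add sg0 _; apply: slow_le (leqnSn s) _; exact: slow_sub.
pose R i j := (lam y ^+ (c * mu i j)) (u i j).
have sR0 : slow s.+1 (fun i j => R i j - u i j).
  apply: slow_le (slow_lam_sub w c ab (slow_le (leq0n s) su)).
  by rewrite ltnS.
have sR : slow 0 (fun i j => D (R i j) h).
  have sg1 : slow s.+1 (fun i j => (g' i j - d i j) + (R i j - u i j)).
    by apply: slow_add sR0; exact: slow_sub.
  apply: eq_slow (IHg _ sg1) => i j; congr (endo_app (D _) _).
  by rewrite addrA -/(u i j) addrC subrK.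
have sl := slow_le (leq0n e.+1) (slow_lam_sub w 1 ab sR).
apply: eq_slow (slow_add (slow_flow_fpow w h ab) (slow_add sR sl)) => i j.
have uE : (lam y ^+ mu i j) (R i j) = u i j.
  rewrite /R -endoM -exprD -mulSn prednK ?expn_gt0 ?prime_gt0 //.
  by rewrite exprM lam_period expr1n endo1.
have -> : f0 i j + g' i j = fpow y (mu i j) + lam (fpow y (mu i j)) (R i j).
  rewrite lam_fpow uE fE /u /d mulrnA -/y opprB !addrA.
  by rewrite [RHS](ACl (4*2*3*(1*5))) /= subrr addr0.
rewrite flow_add endoD endoM lam_fpow mul1n -/y -/(mu i j).
by congr (_ + _); rewrite addrC subrK.
Qed.

Lemma slow_flow x y h : slow 0 (fun i j => D (x *+ i + y *+ j) h).
Proof.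
apply: (slow_flow_le (s := 0)).
have := slow_add (slow_term (s := 0) x (e := 0) (a := 1) (b := 0) isT isT)
                 (slow_term (s := 0) y (e := 0) (a := 0) (b := 1) isT isT).
by apply: eq_slow => i j; rewrite !expn0 !expn1 !mul1n muln1.
Qed.
End Slow.

(** * Recovering the operators from their linear part *)

Lemma sum_convolution (V : zmodType) M (F : nat -> nat -> V) t :
  (forall e, F 0%N e = 0) -> (forall d e, (M <= d + e)%N -> F d e = 0) ->
  \sum_(d < M) \sum_(e < M) F d e *+ t ^ (d + e)
    = \sum_(s < M) (\sum_(d < s) F d.+1 (s - d.+1)%N) *+ t ^ s.
Proof.
move=> F0 FM.
transitivity (\sum_(d < M) \sum_(s < M | (d <= s)%N) F d (s - d)%N *+ t ^ s).
  apply: eq_bigr => d _.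
  rewrite -(big_mkord xpredT (fun e => F d e *+ t ^ (d + e))).
  rewrite -(big_mkord (fun s => d <= s)%N (fun s => F d (s - d)%N *+ t ^ s)).
  have dM := ltnW (ltn_ord d).
  rewrite [RHS](big_cat_nat (leq0n d) dM) [X in _ = X + _]big_nat_cond.
  rewrite [X in _ = X + _]big_pred0 ?add0r => [|s]; last first.
    by rewrite /=; case: leqP; rewrite ?andbF.
  rewrite -[in RHS](add0n d) [RHS]big_addn.
  rewrite [LHS](big_cat_nat (leq0n _) (leq_subr d M)) /= [X in _ + X]big_nat_cond.
  rewrite [X in _ + X]big1 ?addr0 => [|s]; last first.
    by rewrite andbT leq_subLR => /andP [le _]; rewrite FM ?mul0rn.
  apply: eq_big => [s|s _]; first by rewrite add0n leq_addl.
  by rewrite add0n addnK addnC.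
rewrite (exchange_big_dep xpredT) //=; apply: eq_bigr => s _.
rewrite sumrMnl; congr (_ *+ _).
rewrite -(big_mkord (fun d => d <= s)%N (fun d => F d (s - d)%N)).
rewrite [LHS](big_cat_nat (leq0n s.+1) (ltn_ord s)) /= [X in _ + X]big_nat_cond.
rewrite [X in _ + X]big_pred0 ?addr0 => [|d]; last first.
  by rewrite /=; case: (ltnP s d); rewrite ?andbF.
rewrite big_mkord big_mkcond [LHS]big_ord_recl /= F0 add0r.
by apply: eq_bigr => d _; rewrite /= /bump add1n ltn_ord.
Qed.

Section Recursion.
Variables (p n q z : nat) (H : finZmodType).
Hypotheses (p_pr : prime p) (p_gt3 : (3 < p)%N).
Hypothesis Hpn : forall x : H, x *+ p ^ n = 0.
Hypothesis Hq : forall x : H, x *+ q ^ p.-2 = 0.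
Hypothesis z_order : (z ^ p.-1 = 1 %[mod p ^ n])%N.
Hypothesis z_gt0 : (0 < z)%N.
Hypothesis z_prim : forall e, (z ^ e = 1 %[mod p] -> p.-1 %| e)%N.

Local Notation coef := (coef p n z).

(** The pre-Lie product, with the root of unity represented by a natural
    number. *)
Definition bul (D : H -> endo H) (x y : H) : H :=
  \sum_(i < p.-1) D (x *+ z ^ i) y *+ z ^ (p.-1 - i).

Section Law.
Variable D : H -> endo H.
Hypothesis law : flow_law q D.

Let p1_gt1 : (1 < p.-1)%N. Proof. by lia. Qed.

Lemma slow_poly (f : nat -> nat -> H) : slow q 0 f -> exists c : nat -> H,
  (forall t, f t 0%N = \sum_(d < p.-1) c d *+ t ^ d) /\
  (forall d, exists w, c d.+1 = w *+ q ^ d).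
Proof.
elim=> [f0 f00|w e a b f0 g0 _ ab _ [c [cE cq]] fE].
  exists (fun=> 0); split=> [t|d]; last by exists 0; rewrite mul0rn.
  by rewrite f00 big1 // => d _; rewrite mul0rn.
case: b ab fE => [|b] ab fE; last first.
  by exists c; split=> // t; rewrite fE exp0n // !muln0 mulr0n add0r.
rewrite addn0 in ab.
exists (fun d => (if d == a then w *+ q ^ e else 0) + c d); split=> [t|d].
  under eq_bigr do rewrite mulrnDl.
  rewrite big_split fE cE /= expn0 muln1 mulrnA; congr (_ + _).
  case: (ltnP a p.-1) => [ap|pa].
    rewrite (bigD1 (Ordinal ap)) //= eqxx big1 ?addr0 // => d.
    by rewrite -val_eqE /= => /negbTE ->; rewrite mul0rn.
  rewrite (mulq0 Hq) ?mul0rn; last by move: pa ab; lia.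
  by rewrite big1 // => d _; case: eqP; rewrite ?mul0rn.
have [v ->] := cq d; case: eqP => [da|_]; last by exists v; rewrite add0r.
exists (w *+ q ^ (e - d) + v); rewrite mulrnDl -mulrnA -expnD subnK //.
by move: ab; rewrite -da.
Qed.

Definition hpart d x : endo H :=
  (\sum_(i < p.-1) D (x *+ z ^ i) *+ z ^ (i * (p.-1 - d))) *+ unit_inv p n p.-1.

Lemma hpartE d x h : hpart d x h = coef d (fun t => D (x *+ t) h).
Proof.
rewrite endoMn endo_sum; congr (_ *+ _).
by apply: eq_bigr => i _; rewrite endoMn.
Qed.

Let slow1 x h : slow q 0 (fun i j => D (x *+ i) h).
Proof.
apply: eq_slow (slow_flow p_pr p_gt3 Hpn Hq law x 0 h) => i j.
by rewrite mul0rn addr0.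
Qed.

Lemma flow_poly t x h : D (x *+ t) h = \sum_(d < p.-1) hpart d x h *+ t ^ d.
Proof.
have [c [cE _]] := slow_poly (slow1 x h); rewrite cE; apply: eq_bigr => d _.
rewrite hpartE (eq_coef _ cE).
by rewrite (coef_poly p_pr p_gt3 Hpn z_order z_gt0 z_prim).
Qed.

Lemma hpart_mulq d x h : (d.+1 < p.-1)%N -> exists w, hpart d.+1 x h = w *+ q ^ d.
Proof.
move=> dp; have [c [cE cq]] := slow_poly (slow1 x h); have [w wE] := cq d.
exists w; rewrite hpartE (eq_coef _ cE).
by rewrite (coef_poly p_pr p_gt3 Hpn z_order z_gt0 z_prim).
Qed.

Lemma hpart0 x : hpart 0 x = 0.
Proof.
apply: endoP=> h; rewrite endo0.
have : D (x *+ 0) h = 0 by rewrite mulr0n (flow0 law) endo0.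
rewrite flow_poly -(prednK (ltnW p1_gt1)) big_ord_recl expn0 mulr1n.
by rewrite big1 ?addr0 // => d _; rewrite exp0n // mulr0n.
Qed.

(** The weights [z ^ (p - 1 - i)] of [bul] are those that extract the
    coefficient of degree one, because the order of [z] divides [p - 1]. *)
Lemma bulE x y : bul D x y = hpart 1 x y *+ p.-1.
Proof.
have cop : coprime p.-1 p by apply: small_coprime => //; lia.
rewrite /hpart endoMn -mulrnA mulnC (unit_invE p_pr Hpn _ cop) endo_sum.
apply: eq_bigr => i _; rewrite endoMn; apply: (mulrn_mod Hpn).
case: i => [[|i] /= ip]; first by rewrite subn0 mul0n expn0.
have -> : (i.+1 * (p.-1 - 1) = p.-1 * i + (p.-1 - i.+1))%N.
  by rewrite mulnBr muln1; nia.
rewrite expnD expnM -[in RHS]modnMml -(modnXm i _ (z ^ p.-1)) z_order.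
by rewrite modnXm exp1n modnMml mul1n.
Qed.

(** A polynomial without constant term has the same linear coefficient on the
    diagonal as the sum of its linear coefficients along the two axes. *)
Lemma coef1_diag (f : nat -> nat -> H) : slow q 0 f ->
  coef 1 (fun t => f t t) = coef 1 (fun t => f t 0%N) + coef 1 (fun t => f 0%N t).
Proof.
elim=> [f0 f00|w e a b f0 g0 _ ab _ IH fE].
  by rewrite !(eq_coef (fun=> 0)) ?coef_const0 ?addr0 // => t; rewrite f00.
rewrite (eq_coef _ (fun t => fE t t)) (eq_coef _ (fun t => fE t 0%N)).
rewrite (eq_coef _ (fun t => fE 0%N t)) !coefD IH addrACA; congr (_ + _).
have cp d : (d <= a + b)%N ->
    coef 1 (fun t => w *+ (q ^ e * t ^ d)) = if d == 1%N then w *+ q ^ e else 0.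
  move=> dab; case: (ltnP d p.-1) => dp.
    rewrite -(coef_pow p_pr p_gt3 Hpn z_order z_gt0 z_prim) //.
    by apply: eq_coef => t; rewrite mulrnA.
  rewrite (mulq0 Hq); last by move: dp dab ab; lia.
  rewrite if_same -[RHS](coef_const0 p n z H 1); apply: eq_coef => t.
  by rewrite mulrnA (mulq0 Hq) ?mul0rn //; move: dp dab ab; lia.
have cz : coef 1 (fun=> w *+ (q ^ e * 0)) = 0.
  by rewrite -[RHS](coef_const0 p n z H 1); apply: eq_coef => t; rewrite muln0.
rewrite (eq_coef (fun t => w *+ (q ^ e * t ^ (a + b)))); last first.
  by move=> t; rewrite expnD.
rewrite cp //; case: a b {ab fE} cp => [|a] [|b] cp.
- rewrite /= !(eq_coef (fun t => w *+ (q ^ e * t ^ 0))) ?cp //= ?addr0 //.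
- rewrite (@eq_coef _ _ _ _ _ (fun t => w *+ (q ^ e * (t ^ 0 * 0 ^ b.+1)))
    (fun=> w *+ (q ^ e * 0))) ?cz ?add0r; last by move=> t; rewrite exp0n // muln0.
  rewrite (eq_coef (fun t => w *+ (q ^ e * t ^ b.+1))) ?cp //.
  by move=> t; rewrite expn0 mul1n.
- rewrite [X in _ + X](eq_coef (fun=> w *+ (q ^ e * 0))) ?cz ?addr0; last first.
    by move=> t; rewrite exp0n // mul0n.
  rewrite (eq_coef (fun t => w *+ (q ^ e * t ^ a.+1))) ?cp ?addn0 //.
  by move=> t; rewrite expn0 muln1.
rewrite !(eq_coef (fun=> w *+ (q ^ e * 0))) ?cz ?addr0.
- by rewrite addnS.
- by move=> t; rewrite exp0n // mul0n.
- by move=> t; rewrite (exp0n (n := b.+1)) // muln0.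
Qed.

(** The linear part of a polynomial map is additive: this is [coef1_diag] for
    the slow function [D (x *+ i + x' *+ j)]. *)
Lemma bulDl h : {morph (bul D)^~ h : x x' / x + x'}.
Proof.
move=> x x' /=; rewrite !bulE -mulrnDl; congr (_ *+ _); rewrite !hpartE.
have := coef1_diag (slow_flow p_pr p_gt3 Hpn Hq law x x' h).
rewrite (eq_coef (fun t => D ((x + x') *+ t) h)) => [->|t]; last first.
  by rewrite mulrnDl.
by congr (_ + _); apply: eq_coef => t; rewrite mulr0n ?addr0 ?add0r.
Qed.


Definition bulR h : endo H := mk_endo (bulDl h).

Lemma bulRE h x : bulR h x = bul D x h. Proof. exact: mk_endoE. Qed.

Local Notation lam := (lam q D).

Lemma coef1_shift (w : H) t d : (d < p.-1)%N ->
  coef 1 (fun s => w *+ (t + s) ^ d) = w *+ (d * t ^ d.-1).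
Proof.
move=> dp.
rewrite (eq_coef (fun s => \sum_(a < d.+1) w *+ ('C(d, a) * t ^ (d - a)) *+ s ^ a)).
  rewrite coef_sum; case: d dp => [|d] dp.
    by rewrite big_ord1 (coef_pow p_pr p_gt3 Hpn z_order z_gt0 z_prim).
  rewrite big_ord_recl big_ord_recl big1 => [|a _].
    rewrite !(coef_pow p_pr p_gt3 Hpn z_order z_gt0 z_prim) //=; last exact: ltnW.
    by rewrite add0r addr0 bin1 subn1.
  rewrite (coef_pow p_pr p_gt3 Hpn z_order z_gt0 z_prim) //=.
  by have := ltn_ord a; move: dp; rewrite /bump; lia.
move=> s; rewrite expnDn -sumrMnr; apply: eq_bigr => a _.
by rewrite mulnA mulrnA.
Qed.

(** The linear coefficient in [s] of [D (x *+ (t + s))], computed in two ways: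
    from the homogeneous parts of [D], and from the factorization of
    [x *+ (t + s)] as the product of [x *+ t] and [R *+ s]. *)
Lemma flow_ode t x h R : lam (x *+ t) R = x ->
  \sum_(d < p.-1) hpart d x h *+ (d * t ^ d.-1) *+ p.-1 = lam (x *+ t) (bul D R h).
Proof.
move=> RE; rewrite sumrMnl bulE appMn; congr (_ *+ _).
transitivity (coef 1 (fun s => D (x *+ (t + s)) h)).
  rewrite (eq_coef _ (fun s => flow_poly (t + s) x h)) coef_sum.
  by apply: eq_bigr => d _; rewrite coef1_shift.
rewrite (eq_coef (fun s => D (x *+ t) h *+ s ^ 0 + lam (x *+ t) (D (R *+ s) h))).
  rewrite coefD coef_app -hpartE.
  by rewrite (coef_pow p_pr p_gt3 Hpn z_order z_gt0 z_prim) ?add0r // ltnW.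
move=> s; rewrite expn0 mulr1n -endoM -endoD -(flow_add law) appMn RE.
by rewrite mulrnDr.
Qed.

(** [bcoef x e] is the coefficient of [t ^ e] in the solution [R] of
    [lam (x *+ t) R = x]; [bfuel] is the same recursion with a bound [N] on its
    depth. *)
Fixpoint bfuel (x : H) (N e : nat) : H :=
  if N is N'.+1 then
    if e is e'.+1 then
      - \sum_(d < e) hpart d.+1 x (bfuel x N' (e' - d)%N) *+ q
    else x
  else 0.

Definition bcoef x e := bfuel x e.+1 e.

Lemma bfuelE x N e : (e < N)%N -> bfuel x N e = bcoef x e.
Proof.
rewrite /bcoef; elim/ltn_ind: e N => e IH [//|N] eN.
case: e IH eN => [//|e] IH eN /=; congr (- _); apply: eq_bigr => d _.
have le : (e - d < e.+1)%N by rewrite ltnS leq_subr.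
have leN : (e - d < N)%N.
  by rewrite -ltnS; apply: leq_ltn_trans eN; rewrite ltnS leq_subr.
by rewrite (IH _ le N leN) -(IH _ le e.+1 le).
Qed.

Lemma bcoefS x e :
  bcoef x e.+1 = - \sum_(d < e.+1) hpart d.+1 x (bcoef x (e - d)) *+ q.
Proof.
transitivity (- \sum_(d < e.+1) hpart d.+1 x (bfuel x e.+1 (e - d)) *+ q); first by [].
congr (- _); apply: eq_bigr => d _.
by rewrite bfuelE // ltnS leq_subr.
Qed.

Lemma bcoef_mulq x e : (e < p.-1)%N -> exists w, bcoef x e = w *+ q ^ e.
Proof.
elim/ltn_ind: e => -[_ _|e IH ep]; first by exists x; rewrite expn0 mulr1n.
suff [w wE] : exists w,
    \sum_(d < e.+1) hpart d.+1 x (bcoef x (e - d)) *+ q = w *+ q ^ e.+1.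
  by exists (- w); rewrite bcoefS wE mulNrn.
elim/big_rec: _ => [|d y _ [w ->]]; first by exists 0; rewrite mul0rn.
have le : (e - d < e.+1)%N by rewrite ltnS leq_subr.
have [v ->] := IH _ le (leq_ltn_trans (leq_subr _ _) (ltnW ep)).
have de : (d <= e)%N by rewrite -ltnS.
have [u uE] := hpart_mulq x v (leq_ltn_trans (ltn_ord d) ep).
exists (u + w); rewrite appMn uE mulrnDl -!mulrnA -expnSr -expnD.
congr (_ *+ _ ^ _ + _).
by rewrite addnS subnKC.
Qed.

(** Products of homogeneous parts of total degree at least [p - 1] vanish, so
    that no truncation is needed when polynomials are multiplied. *)
Lemma hpart_overflow d e x w : (d < p.-1)%N -> (p.-1 <= d + e)%N ->
  hpart d x (w *+ q ^ e) *+ q = 0.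
Proof.
case: d => [|d] dp de; first by rewrite hpart0 endo0 mul0rn.
have [v vE] := hpart_mulq x w dp.
rewrite appMn vE -!mulrnA -expnSr -expnD (mulq0 Hq) //.
by move: de; lia.
Qed.

Lemma lam_poly x t (c : nat -> H) :
  (forall e, (e < p.-1)%N -> exists w, c e = w *+ q ^ e) ->
  lam (x *+ t) (\sum_(e < p.-1) c e *+ t ^ e) =
  \sum_(s < p.-1) (c s + \sum_(d < s) hpart d.+1 x (c (s - d.+1)%N) *+ q) *+ t ^ s.
Proof.
move=> cq; rewrite lamE app_sum.
under [RHS]eq_bigr do rewrite mulrnDl.
rewrite big_split /=; congr (_ + _).
pose F d e := if (d < p.-1)%N && (e < p.-1)%N then hpart d x (c e) *+ q else 0.
transitivity (\sum_(d < p.-1) \sum_(e < p.-1) F d e *+ t ^ (d + e)).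
  rewrite -sumrMnl exchange_big /=; apply: eq_bigr => e _.
  rewrite flow_poly -sumrMnl; apply: eq_bigr => d _.
  by rewrite /F !ltn_ord appMn -!mulrnA expnD; congr (_ *+ _); lia.
rewrite sum_convolution.
- apply: eq_bigr => s _; congr (_ *+ _); apply: eq_bigr => d _.
  rewrite /F (leq_ltn_trans (ltn_ord d) (ltn_ord s)).
  by rewrite (leq_ltn_trans (leq_subr _ _) (ltn_ord s)).
- by move=> e; rewrite /F hpart0 endo0 mul0rn if_same.
move=> d e de; rewrite /F; case: andP => // -[dp ep].
by have [w ->] := cq e ep; rewrite hpart_overflow.
Qed.

Lemma lam_bcoef x t : lam (x *+ t) (\sum_(e < p.-1) bcoef x e *+ t ^ e) = x.
Proof.
rewrite lam_poly; last exact: bcoef_mulq.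
rewrite -(prednK (ltnW p1_gt1)) big_ord_recl [X in _ + X]big1 => [|s _].
  by rewrite /= big_ord0 expn0 !addr0.
by rewrite bcoefS addNr mul0rn.
Qed.

(** The coefficients of [t ^ d] on both sides of [flow_ode]; the solution [R]
    and the right-hand side involve homogeneous parts of smaller degree only. *)
Lemma hpart_rec d x h : (d.+1 < p.-1)%N ->
  hpart d.+1 x h *+ (d.+1 * p.-1) =
    bul D (bcoef x d) h
    + \sum_(i < d) hpart i.+1 x (bul D (bcoef x (d - i.+1)%N) h) *+ q.
Proof.
move=> dp; have dp' := ltnW dp.
pose c e := bul D (bcoef x e) h.
have cq e : (e < p.-1)%N -> exists w, c e = w *+ q ^ e.
  move=> ep; have [w wE] := bcoef_mulq x ep.
  by exists (bul D w h); rewrite /c wE -!bulRE appMn.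
pose r s := c s + \sum_(i < s) hpart i.+1 x (c (s - i.+1)%N) *+ q.
pose l e := if (e.+1 < p.-1)%N then hpart e.+1 x h *+ (e.+1 * p.-1) else 0.
have lr t : \sum_(e < p.-1) l e *+ t ^ e = \sum_(e < p.-1) r e *+ t ^ e.
  have := flow_ode h (lam_bcoef x t).
  rewrite -[in bul _ _ _]bulRE app_sum.
  under [X in lam _ X]eq_bigr do rewrite appMn bulRE.
  rewrite (lam_poly x t cq) => <-; rewrite /l.
  case ME: p.-1 p1_gt1 => [//|M] _.
  rewrite big_ord_recr /= ltnn mul0rn addr0 [RHS]big_ord_recl mul0n mulr0n mul0rn add0r.
  by apply: eq_bigr => e _; rewrite ltnS ltn_ord /= -!mulrnA; rewrite mulnAC.
have := coef_poly p_pr p_gt3 Hpn z_order z_gt0 z_prim l dp'.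
rewrite (eq_coef _ lr) (coef_poly p_pr p_gt3 Hpn z_order z_gt0 z_prim _ dp').
by rewrite /l dp => <-.
Qed.

End Law.

(** The expression is chosen before [D]: it may depend on the group but not on
    the brace. *)
Definition expressible (phi : (H -> endo H) -> H -> H -> H) : Prop :=
  exists e, forall D, flow_law q D -> forall x y,
    phi D x y = eval_expr (bul D) x y e.

Lemma eq_expressible phi psi : expressible phi ->
  (forall D, flow_law q D -> forall x y, psi D x y = phi D x y) ->
  expressible psi.
Proof. by move=> [e eE] E; exists e => D law x y; rewrite E // eE. Qed.

Lemma expressible_add phi psi : expressible phi -> expressible psi ->
  expressible (fun D x y => phi D x y + psi D x y).
Proof.
by move=> [e eE] [f fE]; exists (EAdd e f) => D law x y; rewrite eE // fE.
Qed.

Lemma expressible_bul phi psi : expressible phi -> expressible psi ->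
  expressible (fun D x y => bul D (phi D x y) (psi D x y)).
Proof.
by move=> [e eE] [f fE]; exists (EMul e f) => D law x y; rewrite eE // fE.
Qed.

(** Expressions have neither zero nor opposite; adding [p ^ n] to the multiplier
   makes it positive without changing the value. *)
Lemma expressible_mulrn c phi : expressible phi ->
  expressible (fun D x y => phi D x y *+ c).
Proof.
move=> [e eE]; exists (iter (c + (p ^ n).-1) (EAdd e) e) => D law x y.
have -> N : eval_expr (bul D) x y (iter N (EAdd e) e) = phi D x y *+ N.+1.
  by elim: N => [|N IH] /=; rewrite ?IH -?eE // -mulrS.
by rewrite -addnS prednK ?expn_gt0 ?prime_gt0 // mulrnDr Hpn addr0.
Qed.

Lemma expressible_opp phi : expressible phi -> expressible (fun D x y => - phi D x y).
Proof.
move=> h; apply: eq_expressible (expressible_mulrn (p ^ n).-1 h) _ => D law x y.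
apply/eqP; rewrite eq_sym -subr_eq0 opprK -mulrSr prednK ?expn_gt0 ?prime_gt0 //.
by rewrite Hpn.
Qed.

Lemma expressible_sum N (phi : nat -> (H -> endo H) -> H -> H -> H) :
  (forall i, (i < N)%N -> expressible (phi i)) ->
  expressible (fun D x y => \sum_(i < N) phi i D x y).
Proof.
elim: N => [|N IH] h.
  have: expressible (fun _ x _ => x) by exists EX.
  move/(expressible_mulrn 0) => h0.
  by apply: eq_expressible h0 _ => D _ x y; rewrite big_ord0.
have hN : expressible (fun D x y => \sum_(i < N) phi i D x y).
  by apply: IH => i iN; apply/h/ltnW.
apply: eq_expressible (expressible_add hN (h N (ltnSn N))) _ => D _ x y.
by rewrite big_ord_recr.
Qed.

Fixpoint expr_subst (f e : prelie_expr) : prelie_expr :=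
  match e with
  | EX => EX
  | EY => f
  | EAdd e1 e2 => EAdd (expr_subst f e1) (expr_subst f e2)
  | EMul e1 e2 => EMul (expr_subst f e1) (expr_subst f e2)
  end.

Lemma expressible_subst phi psi : expressible phi -> expressible psi ->
  expressible (fun D x y => phi D x (psi D x y)).
Proof.
move=> [e eE] [f fE]; exists (expr_subst f e) => D law x y.
rewrite eE // fE //.
by elim: e {eE} => //= [e1 -> e2 ->|e1 -> e2 ->].
Qed.

Lemma hpart_expressible d :
  ((d < p.-1)%N -> expressible (fun D x _ => bcoef D x d)) /\
  ((d.+1 < p.-1)%N -> expressible (fun D x y => hpart D d.+1 x y)).
Proof.
elim/ltn_ind: d => d IH.
have hb : (d < p.-1)%N -> expressible (fun D x _ => bcoef D x d).
  case: d IH => [|d] IH dp; first by exists EX.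
  have hs : expressible (fun D x y =>
      \sum_(i < d.+1) hpart D i.+1 x (bcoef D x (d - i)) *+ q).
    apply: (expressible_sum (phi := fun i D x y =>
      hpart D i.+1 x (bcoef D x (d - i)) *+ q)) => i id.
    apply: expressible_mulrn.
    have ip := leq_ltn_trans id dp.
    have di : (d - i < d.+1)%N by rewrite ltnS leq_subr.
    have dip : (d - i < p.-1)%N by exact: ltn_trans di dp.
    exact: (expressible_subst ((IH i id).2 ip) ((IH _ di).1 dip)).
  apply: eq_expressible (expressible_opp hs) _ => D law x y.
  exact: bcoefS.
split=> // dp.
have dp' := ltnW dp.
have hY : expressible (fun _ _ y => y) by exists EY.
have hc e : (e <= d)%N -> expressible (fun D x y => bul D (bcoef D x e) y).
  move=> ed; apply: expressible_bul hY.
  case: (ltngtP e d) ed => // [ed _|-> _]; last exact: hb.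
  exact: (IH e ed).1 (ltn_trans ed dp').
have hr : expressible (fun D x y => bul D (bcoef D x d) y +
    \sum_(i < d) hpart D i.+1 x (bul D (bcoef D x (d - i.+1)%N) y) *+ q).
  apply: expressible_add; first exact: hc.
  apply: (expressible_sum (phi := fun i D x y =>
    hpart D i.+1 x (bul D (bcoef D x (d - i.+1)%N) y) *+ q)) => i id.
  apply: expressible_mulrn.
  apply: (expressible_subst ((IH i id).2 (leq_ltn_trans id dp'))).
  exact/hc/leq_subr.
apply: eq_expressible
  (expressible_mulrn (unit_inv p n (d.+1 * p.-1)) hr) _ => D law x y.
rewrite -hpart_rec // -mulrnA unit_invE // coprimeMl.
by rewrite !small_coprime //; lia.
Qed.

Lemma flow_expressible : expressible (fun D x y => D x y).
Proof.
have h : expressible (fun D x y => \sum_(d < p.-2) hpart D d.+1 x y).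
  apply: (expressible_sum (phi := fun d D x y => hpart D d.+1 x y)) => d dp.
  by apply: (hpart_expressible d).2; move: dp; lia.
apply: eq_expressible h _ => D law x y.
rewrite -{1}[x]mulr1n (flow_poly law).
have -> : p.-1 = p.-2.+1 by lia.
rewrite big_ord_recl (hpart0 law) endo0 mul0rn add0r.
by apply: eq_bigr => d _; rewrite exp1n mulr1n.
Qed.

End Recursion.

(** * Formal terms *)

Section Terms.
Variables (p m n k : nat) (H : finZmodType).
Hypotheses (p_pr : prime p) (m_gt0 : (0 < m)%N) (m_le : (4 * m <= p.-1)%N).
Hypothesis Hpn : forall x : H, x *+ p ^ n = 0.

(** As for expressions, the multiplier is shifted by [p ^ n] because there is no
    term for zero. *)
Definition term_mulrn (t : Pterm) (c : nat) : Pterm :=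
  iter (c + (p ^ n).-1) (PAdd t) t.

Fixpoint term_expr (s t : Pterm) (e : prelie_expr) : Pterm :=
  match e with
  | EX => s
  | EY => t
  | EAdd e1 e2 => PAdd (term_expr s t e1) (term_expr s t e2)
  | EMul e1 e2 => PMul (term_expr s t e1) (term_expr s t e2)
  end.

Definition term_sum (t : Pterm) (ts : seq Pterm) : Pterm :=
  foldr PAdd (term_mulrn t 0) ts.

Definition term_divpow (T : Pterm -> Pterm) (t : Pterm) : Pterm :=
  iter m T (PDiv (iter m T t)).

Definition term_rootU (T : Pterm -> Pterm) (t : Pterm) : Pterm :=
  term_sum t [seq term_mulrn (iter (i - 2 * m * logn p i.+1) T
    (iter (logn p i.+1) (term_divpow T) t)) (dcoef p k i.+1) | i <- iota 0 (p ^ k)].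

Definition term_rootF (T : Pterm -> Pterm) (t : Pterm) : Pterm :=
  T (term_rootU T t).

Definition op_period : nat := #|{: endo H}|`!.

(** If [s] has value [v] and [e] expresses [D], the transformer [term_flow e s]
    realizes the operator [l] with [rootF l = D v]. *)
Definition term_flow (e : prelie_expr) (s : Pterm) : Pterm -> Pterm :=
  iter op_period.-1 term_rootF (fun t => term_expr s t e).

(** The preimage [u] of the value of [s] under [u |-> rootU (L u) u]. *)
Definition term_unroot (e : prelie_expr) (s : Pterm) : Pterm :=
  iter op_period.-1 (term_rootU (term_flow e s)) s.

(** The iterate of [term_unroot] is the map [u |-> rootU (L u) u] itself, as
    [term_unroot] is a permutation. *)
Definition term_star (e : prelie_expr) : Pterm :=
  term_flow e (iter (#|H|`!).-1 (term_unroot e) PX) PY.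

Section Values.
Variables (mul : H -> H -> H) (rho : H -> H) (x y : H).
Hypothesis rhoK : division_fun p rho.

Definition computes (t : Pterm) (v : H) : Prop :=
  definedP p mul rho x y t /\ evalP mul rho x y t = v.

(** Operators are represented by transformers of terms, because they have to be
    applied to the result of a division. *)
Definition realizes (T : Pterm -> Pterm) (l : endo H) : Prop :=
  forall t v, computes t v -> computes (T t) (l v).

Lemma computes_add s t u v :
  computes s u -> computes t v -> computes (PAdd s t) (u + v).
Proof. by move=> [ds <-] [dt <-]. Qed.

Lemma computes_mulrn t v c : computes t v -> computes (term_mulrn t c) (v *+ c).
Proof.
move=> tv; have it N : computes (iter N (PAdd t) t) (v *+ N.+1).
  elim: N => [|N IH]; first by rewrite mulr1n.
  by rewrite mulrS; exact: computes_add.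
have := it (c + (p ^ n).-1)%N.
by rewrite -addnS prednK ?expn_gt0 ?prime_gt0 // mulrnDr Hpn addr0.
Qed.

Lemma computes_expr s t u v e : computes s u -> computes t v ->
  computes (term_expr s t e) (eval_expr mul u v e).
Proof.
move=> su tv; elim: e => [||e1 IH1 e2 IH2|e1 IH1 e2 IH2] //=.
  exact: computes_add.
by case: IH1 => d1 <-; case: IH2 => d2 <-.
Qed.

Lemma computes_sum t v (ts : nat -> Pterm) (vs : nat -> H) N :
  computes t v -> (forall i, computes (ts i) (vs i)) ->
  computes (term_sum t [seq ts i | i <- iota 0 N]) (\sum_(i < N) vs i).
Proof.
move=> tv tvs; rewrite -(big_mkord xpredT) /index_iota subn0.
elim: (iota 0 N) => [|i s IH]; first by rewrite big_nil; exact: computes_mulrn 0%N tv.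
by rewrite big_cons; apply: computes_add.
Qed.

Lemma realizes_exp T l e : realizes T l -> realizes (iter e T) (l ^+ e).
Proof.
move=> Tl t v tv; elim: e => [|e IH]; first by rewrite expr0 endo1.
by rewrite exprS endoM; exact: Tl.
Qed.

(** The division is performed on a multiple of [p], and its result is
    multiplied by [l ^ m]: the value does not depend on [rho]. *)
Lemma realizes_divpow T l : contracting p m l ->
  realizes T l -> realizes (term_divpow T) (divpow p m l).
Proof.
move=> lc Tl t v tv; have [z zE] := lc.1 v.
have [dt et] := realizes_exp m Tl tv.
have h : computes (PDiv (iter m T t)) (rho ((l ^+ m) v)).
  by split; [split=> //; rewrite et zE; exists z | rewrite /= et].
have := realizes_exp m Tl h; rewrite (divpowE (z := rho ((l ^+ m) v)) lc) //.
by rewrite rhoK // zE; exists z.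
Qed.

Lemma realizes_rootU T l : contracting p m l ->
  realizes T l -> realizes (term_rootU T) (rootU p m k l).
Proof.
move=> lc Tl t v tv; rewrite endo_sum.
pose ts i := term_mulrn (iter (i - 2 * m * logn p i.+1) T
    (iter (logn p i.+1) (term_divpow T) t)) (dcoef p k i.+1).
pose vs i := ((l ^+ (i - 2 * m * logn p i.+1)
  * divpow p m l ^+ logn p i.+1) *+ dcoef p k i.+1) v.
have tvs i : computes (ts i) (vs i).
  rewrite /vs endoMn endoM; apply: computes_mulrn; apply: (realizes_exp _ Tl).
  by apply: realizes_exp tv; exact: realizes_divpow.
exact: (computes_sum (p ^ k) tv tvs).
Qed.

Lemma realizes_rootF T l : contracting p m l ->
  realizes T l -> realizes (term_rootF T) (rootF p m k l).
Proof.
by move=> lc Tl t v tv; rewrite endoM; exact: Tl (realizes_rootU lc Tl tv).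
Qed.

Lemma realizes_iter_rootF N T l : contracting p m l -> realizes T l ->
  realizes (iter N term_rootF T) (iter N (rootF p m k) l).
Proof.
move=> lc Tl; elim: N => // N IH; rewrite !iterS; apply: realizes_rootF IH.
exact: iter_rootF.
Qed.

Variables (D L : H -> endo H) (e : prelie_expr).
Hypothesis DE : forall u v, D u v = eval_expr mul u v e.
Hypothesis Lc : forall u, contracting p m (L u).
Hypothesis DL : forall u, D (rootU p m k (L u) u) = rootF p m k (L u).

Let h u := rootU p m k (L u) u.
Let op v := iter op_period.-1 (rootF p m k) (D v).
Let unroot v := (rootU p m k (op v) ^+ op_period.-1) v.

Lemma op_root u : op (h u) = L u.
Proof. by rewrite /op DL (iter_rootF_pred p_pr m_gt0 m_le Hpn). Qed.

Lemma unroot_root u : unroot (h u) = u.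
Proof.
rewrite /unroot op_root -endoM -exprSr prednK ?fact_gt0 //.
by rewrite (rootU_period p_pr m_gt0 m_le Hpn) // endo1.
Qed.

(** [h] has the left inverse [unroot] and acts on a finite set. *)
Lemma root_surj v : exists u, v = h u.
Proof.
have [g _ hg] := injF_bij (can_inj unroot_root).
by exists (g v); rewrite hg.
Qed.

Lemma root_unroot v : h (unroot v) = v.
Proof. by have [u ->] := root_surj v; rewrite unroot_root. Qed.

Lemma op_contracting v : contracting p m (op v).
Proof. by have [u ->] := root_surj v; rewrite op_root. Qed.

Lemma flow_contracting v : contracting p m (D v).
Proof.
have [u ->] := root_surj v; rewrite /h DL; exact: rootF_contracting.
Qed.

Lemma realizes_op s v : computes s v -> realizes (term_flow e s) (op v).
Proof.
move=> sv; apply: realizes_iter_rootF; first exact: flow_contracting.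
by move=> t u tu; rewrite DE; exact: computes_expr.
Qed.

Lemma computes_unroot s v : computes s v -> computes (term_unroot e s) (unroot v).
Proof.
move=> sv; have opU := realizes_rootU (op_contracting v) (realizes_op sv).
exact: (realizes_exp _ opU sv).
Qed.

(** [unroot] is a permutation, so that [h x] is an iterate [x'] of [unroot] at
    [x], and [L x] is the operator recovered from [D x']. *)
Lemma computes_star : computes (term_star e) (L x y).
Proof.
pose x' := iter (#|H|`!).-1 unroot x.
have -> : L x = op x'.
  rewrite -(op_root x); congr (op _); rewrite -(root_unroot x'); congr (h _).
  rewrite /x' -iterS prednK ?fact_gt0 // (iter_fact_card (S := predT)) //.
  by move=> u v _ _; exact: (can_inj root_unroot).
have x'P : computes (iter (#|H|`!).-1 (term_unroot e) PX) x'.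
  by rewrite /x'; elim: _.-1 => [|N IH] //; exact: computes_unroot IH.
exact: (realizes_op x'P).
Qed.

End Values.
End Terms.

(** * Primitive roots *)

Lemma PoszX (g e : nat) : (g ^ e)%N%:Z = g%:Z ^+ e.
Proof. by elim: e => // e IH; rewrite expnS PoszM IH exprS. Qed.

Lemma expn_mod_period (g a j N : nat) : (g ^ a = 1 %[mod N])%N ->
  (g ^ j = g ^ (j %% a) %[mod N])%N.
Proof.
move=> ga; rewrite {1}(divn_eq j a) expnD mulnC [(_ %/ _ * _)%N]mulnC expnM.
by rewrite -modnMmr -modnXm ga modnXm exp1n modnMmr muln1.
Qed.

(** [gamma ^ (p ^ (n - 1))] has order dividing [p - 1] modulo [p ^ n] by Euler's
    theorem, and is congruent to [gamma] modulo [p] by Fermat's; [gamma]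
    generates the units modulo [p], hence has order [p - 1] there. *)
Lemma primitive_root_lift (p n : nat) (gamma : int) :
  prime p -> (0 < n)%N -> primitive_root gamma (p ^ n) ->
  exists z : nat, [/\ (gamma ^+ (p ^ (n - 1)) = z%:Z %[mod (p ^ n)%N])%Z,
    (0 < z)%N, (z ^ p.-1 = 1 %[mod p ^ n])%N
    & forall e, (z ^ e = 1 %[mod p] -> p.-1 %| e)%N].
Proof.
move=> p_pr n_gt0 [cop gen]; set N := (p ^ n)%N in cop gen *.
have N_gt0 : (0 < N)%N by rewrite expn_gt0 prime_gt0.
have pN : (p %| N)%N by rewrite /N -(prednK n_gt0) expnS dvdn_mulr.
have [g gE] : exists g : nat, (gamma = g%:Z %[mod N])%Z.
  exists `|(gamma %% N)%Z|%N; rewrite gez0_abs ?modz_mod //.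
  by rewrite modz_ge0 // eqz_nat -lt0n.
have gX e : (gamma ^+ e = (g ^ e)%N%:Z %[mod N])%Z.
  by rewrite -modzXm gE modzXm PoszX.
have gN : coprime g N.
  by move: cop; rewrite /coprimez -gcdz_modl gE gcdz_modl.
have gp : coprime g p by apply: coprime_dvdr gN.
have g_gt0 : (0 < g)%N.
  by case: g gp {gE gX gN} => //; rewrite /coprime gcd0n => /eqP p1; rewrite p1 in p_pr.
exists (g ^ (p ^ (n - 1)))%N; split; [exact: gX | by rewrite expn_gt0 g_gt0 | |].
  have := Euler_exp_totient gN; rewrite totient_pfactor // => <-.
  by rewrite -expnM mulnC subn1.
move=> e ze.
have gP : (g ^ (p ^ (n - 1)) = g %[mod p])%N.
  elim: (n - 1)%N => [|j IH]; first by rewrite expn0 expn1.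
  by rewrite expnS mulnC expnM fermat_little.
have ge : (g ^ e = 1 %[mod p])%N by rewrite -ze -modnXm -gP modnXm.
have gr : (g ^ (e %% p.-1) = 1 %[mod p])%N.
  rewrite -expn_mod_period //.
  by have := Euler_exp_totient gp; rewrite totient_prime.
rewrite /dvdn; apply: contraT; rewrite -lt0n => r_gt0.
set r := (e %% p.-1)%N in gr r_gt0.
have rp : (r < p.-1)%N by rewrite ltn_mod -subn1 subn_gt0 prime_gt1.
(* The powers of [g] modulo [p] would take at most [r] values. *)
have sub : {subset iota 1 p.-1 <= [seq (g ^ j %% p)%N | j <- iota 0 r]}.
  move=> c; rewrite mem_iota add1n (prednK (prime_gt0 p_pr)) => /andP [c0 cp].
  have cN : coprimez c%:Z N.
    by rewrite coprimezE !absz_nat coprimeXr // (small_coprime p_pr) // c0.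
  have [j cj] := gen _ cN.
  apply/mapP; exists (j %% r)%N; first by rewrite mem_iota /= add0n ltn_mod.
  have : (c = g ^ j %[mod N])%N.
    by apply/eqP; have /eqP := etrans cj (gX j); rewrite !modz_nat eqz_nat.
  move/(congr1 (modn^~ p)); rewrite !modn_dvdm // modn_small // => ->.
  exact: expn_mod_period.
have := uniq_leq_size (iota_uniq 1 p.-1) sub.
by rewrite size_map !size_iota leqNgt rp.
Qed.

(** * Comparison with the pre-Lie ring of a brace *)

(** Translation by [x] permutes the summands of the sum of all elements. *)
Lemma mulrn_card (G : finZmodType) (x : G) : x *+ #|G| = 0.
Proof.
apply: (addrI (\sum_(g : G) g)); rewrite addr0 -sumr_const -big_split /=.
by rewrite [RHS](reindex_inj (addIr x)).
Qed.

Lemma mulrz_mod (p n : nat) (H : zmodType) (x : H) (a b : int) :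
  (forall x : H, x *+ p ^ n = 0) -> (a = b %[mod (p ^ n)%N])%Z -> x *~ a = x *~ b.
Proof.
move=> Hpn ab; have x0 (c : int) : x *~ (c * (p ^ n)%N%:Z) = 0.
  by rewrite mulrzA -pmulrn Hpn.
rewrite (divz_eq a (p ^ n)%N) (divz_eq b (p ^ n)%N) ab !mulrzDr.
by rewrite !x0.
Qed.

Lemma eq_eval_expr (P : zmodType) (f g : P -> P -> P) x y e :
  f =2 g -> eval_expr f x y e = eval_expr g x y e.
Proof.
by move=> fg; elim: e => //= [e1 -> e2 -> //|e1 -> e2 ->]; rewrite fg.
Qed.

Lemma bullet_bul (p n k z : nat) (gamma : int) (G : finZmodType) (B : brace G)
    (winv : G -> G) (D : finquot G (p ^ (2 * k)) -> endo (finquot G (p ^ (2 * k)))) :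
  (forall x : G, x *+ p ^ n = 0) ->
  (gamma ^+ (p ^ (n - 1)) = z%:Z %[mod (p ^ n)%N])%Z ->
  (forall x y, D x y = odot p k B winv x y) ->
  bullet p n k gamma B winv =2 bul p z D.
Proof.
move=> Gpn gz DE x y.
have Ppn (u : quot_ann G (p ^ (2 * k))) : u *+ p ^ n = 0.
  rewrite -(qreprK (u : finquot _ _)); set a := qrepr _.
  by rewrite -[LHS](raddfMn (qpi _)) Gpn raddf0.
have gzX e : ((gamma ^+ (p ^ (n - 1))) ^+ e = (z ^ e)%N%:Z %[mod (p ^ n)%N])%Z.
  by rewrite -(modzXm e (gamma ^+ _)) gz modzXm (PoszX z e).
rewrite /bullet /bul subn1; apply: eq_bigr => i _.
rewrite (mulrz_mod _ Ppn (gzX _)) (mulrz_mod _ Ppn (gzX _)) -!pmulrn.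
by rewrite DE.
Qed.

Theorem theorem22 (p n k : nat) (gamma : int) (G : finZmodType)
    (p_prime : prime p) (p_gt3 : (3 < p)%N)
    (gamma_root : primitive_root gamma (p ^ n))
    (card_G : #|G| = (p ^ n)%N)
    (exp_G : forall g : G, g *+ (p ^ (k * (p - 1))) = 0) :
  exists (q' : prelie_expr) (t : Qterm),
  forall (B : brace G) (winv : G -> G),
    property1' p B -> property1'' p B -> division_fun (p ^ k) winv ->
    let P := quot_ann G (p ^ (2 * k)) in
    let Q := quot_ann G (p ^ (4 * k)) in
    let bar : P -> Q := coset_map (p ^ (4 * k)) in
    let dot : P -> P -> P := odot p k B winv in
    let bul : P -> P -> P := bullet p n k gamma B winv in
    (forall a b : G,
       dot (\pi_P a) (\pi_P b) *+ (p ^ (2 * k))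
       = eval_expr bul (\pi_P a) (\pi_P b) q')
    /\
    ((forall x y : P, bar x + bar y = bar (x + y)) /\
     (forall (x y : P) (rhoP : P -> P) (rhoQ : Q -> Q),
        division_fun p rhoP -> division_fun p rhoQ ->
        definedQ p bul bar rhoP rhoQ x y t /\
        star (quot_circ B (p ^ (4 * k))) (bar x) (bar y)
        = evalQ bul bar rhoP rhoQ x y t)).
Proof.
have Gpn (x : G) : x *+ p ^ n = 0.
  by rewrite -card_G mulrn_card.
(* For [n = 0] the group is trivial and [gamma] carries no information. *)
case: (posnP n) => [n0|n_gt0].
  have triv N (x y : quot_ann G N) : x = y.
    have G0 (a : G) : a = 0 by rewrite -[a]mulr1n -(Gpn a) n0.
    by rewrite -[x]reprK -[y]reprK [repr x]G0 [repr y]G0.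
  exists EX, (QCoset PX) => B winv _ _ _ P Q bar dot bul.
  by split=> [a b|]; [exact: triv | split=> *; [exact: triv | split=> //; exact: triv]].
have [z [gz z_gt0 z_order z_prim]] := primitive_root_lift p_prime n_gt0 gamma_root.
pose H := finquot G (p ^ (2 * k)).
have Hpn (x : H) : x *+ p ^ n = 0.
  by rewrite -(qreprK x) -raddfMn Gpn raddf0.
have Hq (x : H) : x *+ (p ^ k) ^ p.-2 = 0.
  rewrite -(qreprK x) -raddfMn -(raddf0 (qpi _)); apply/qpiP/eqP.
  rewrite subr0 -expnM -mulrnA -expnD.
  have -> : (k * p.-2 + 2 * k = k * (p - 1) + k)%N by nia.
  by rewrite expnD mulrnA exp_G mul0rn.
have dotE := flow_expressible p_prime p_gt3 Hpn Hq z_order z_gt0 z_prim.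
have [q' q'E] := expressible_mulrn p_prime Hpn (p ^ (2 * k)) dotE.
have [e eE] := dotE.
pose m := ((p - 1) %/ 4)%N.
exists q', (QCoset (term_star p m n k H e)) => B winv B1 B2 winvK P Q bar dot bul.
pose D := doto p_prime p_gt3 Gpn B1 B2 winvK : H -> endo H.
have law : flow_law (p ^ k) D.
  split; [exact: doto0 | exact: doto_circ | move=> x j y].
  by rewrite -expnM; exact: doto_mulp.
have DE x y : D x y = odot p k B winv x y by exact: dotoE.
have bulE := bullet_bul Gpn gz DE.
split=> [a b|].
  rewrite (eq_eval_expr _ _ _ bulE); rewrite -q'E //.
  by rewrite DE.
have dvd24 : (p ^ (2 * k) %| p ^ (4 * k))%N by rewrite dvdn_exp2l // leq_mul2r orbT.
split=> [x y|x y rhoP rhoQ rhoPK _]; first exact: esym (coset_mapD dvd24 x y).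
have De (u v : H) : D u v = eval_expr (bul : H -> H -> H) u v e.
  by rewrite (eq_eval_expr _ _ _ bulE); exact: eE.
have Lc (u : H) : contracting p m (qstaro B u) by exact: qstaro_contracting.
have DL (u : H) : D (rootU p m k (qstaro B u) u) = rootF p m k (qstaro B u).
  exact: doto_root.
have [def val] := computes_star p_prime (quarter_gt0 p_prime p_gt3)
  (quarter_le p) Hpn (x : H) (y : H) rhoPK De Lc DL.
split; first exact: def.
rewrite [RHS]/= val; pose a := repr x; pose b := repr y.
have barE c : bar (\pi_P c) = \pi_Q c by exact: coset_map_pi.
have bar_repr (u : P) : bar u = \pi_Q (repr u) by rewrite -(barE (repr u)) reprK.
have -> : qstaro B (x : H) (y : H) = \pi_P (star B a b).
  rewrite -(staroE B a b).
  apply: etrans (inducedE (p ^ (2 * k)) (staro B a) b).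
  by congr (endo_app _ _); exact: esym (reprK y).
rewrite barE !bar_repr.
exact: (star_quot (4 * k) a b p_prime p_gt3 Gpn B1 B2).
Qed.
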